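(* Let $M$ be a connected $N$-dimensional Riemannian manifold with an almost even-Clifford hermitian structure of rank $r\geq 3$, with multiplicity $m$ (so $N=d_rm$) if $r\not\equiv 0\pmod 4$, or multiplicities $m_1,m_2$ (so $N=d_r(m_1+m_2)$) if $r\equiv 0\pmod 4$. Then $\dim(\mathrm{Aut}(M))\leq d_{max}$, where, according to $r$ mod $8$: - $r\equiv0$: $d_{max}=\binom{m_1}{2}+\binom{m_2}{2}+\binom r2+d_r(m_1+m_2)$; - $r\equiv1,7$: $d_{max}=\binom m2+\binom r2+d_rm$; - $r\equiv2,6$: $d_{max}=m^2+\binom r2+d_rm$; - $r\equiv3,5$: $d_{max}=\binom{2m+1}{2}+\binom r2+d_rm$; - $r\equiv4$: $d_{max}=\binom{2m_1+1}{2}+\binom{2m_2+1}{2}+\binom r2+d_r(m_1+m_2)$.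
   Context: Let $Cl_r$ be the Clifford algebra generated by an orthonormal basis $e_1,\dots,e_r$ of $\mathbb{R}^r$ with $e_je_k+e_ke_j=-2\delta_{jk}$, and $Cl_r^0$ its even subalgebra; $\mathfrak{spin}(r)=\mathrm{span}\{e_ie_j: 1\le i<j\le r\}\subset Cl_r^0$. If $r\not\equiv 0\pmod 4$, $\tilde\Delta_r$ is the unique irreducible real representation of $Cl_r^0$; if $r\equiv0\pmod 4$, $\tilde\Delta_r^\pm$ are the two inequivalent irreducible real representations. Their real dimension is denoted $d_r$: $d_r=2^{(r-1)/2}$ for $r\equiv 1,7$; $d_r=2^{r/2}$ for $r\equiv 2,4,6$; $d_r=2^{(r+1)/2}$ for $r\equiv 3,5$; $d_r=2^{r/2-1}$ for $r\equiv 0 \pmod 8$. A linear even-Clifford hermitian structure of rank $r$ on a Euclidean space $\mathbb{R}^N$ is a representation $Cl_r^0\to\mathrm{End}(\mathbb{R}^N)$ such that each $e_ie_j$, $i<j$, is mapped to a skew-symmetric endomorphism $J_{ij}$ with $J_{ij}^2=-\mathrm{Id}$. Then $\mathbb{R}^N\cong\tilde\Delta_r\otimes\mathbb{R}^m$, $N=d_rm$, if $r\not\equiv0\pmod 4$, and $\mathbb{R}^N\cong\tilde\Delta_r^+\otimes\mathbb{R}^{m_1}\oplus\tilde\Delta_r^-\otimes\mathbb{R}^{m_2}$, $N=d_r(m_1+m_2)$, if $r\equiv0\pmod 4$ (one of $m_1,m_2$ may be $0$); $m$, $m_1,m_2$ are called the multiplicities. A rank $r$ almost even-Clifford hermitian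 structure on a Riemannian manifold $M$ is a smoothly varying choice of linear even-Clifford hermitian structure of rank $r$ on each tangent space; locally it is given by smooth endomorphism fields $J_{ij}$, and $Q\subset\mathrm{End}^-(TM)$ denotes the subbundle of skew-symmetric endomorphisms locally spanned by the $J_{ij}$ (the image of $\mathfrak{spin}(r)$). $\mathrm{Aut}(M)$ is the group of isometries of $M$ preserving the structure (i.e. preserving $Q$); its Lie algebra consists of the Killing fields $X$ with, locally, $\mathcal{L}_XJ_{ij}=\sum_{k<l}\alpha^{(ij)}_{kl}J_{kl}$ for some local functions $\alpha^{(ij)}_{kl}$. *)

(* Defs.v *)
From HB Require Import structures.
From mathcomp Require Import all_boot all_order all_algebra.
From mathcomp Require Import all_classical all_reals all_analysis.

Set Implicit Arguments.
Unset Strict Implicit.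
Unset Printing Implicit Defensive.

Import Order.TTheory GRing.Theory Num.Theory numFieldNormedType.Exports.

Local Open Scope classical_set_scope.
Local Open Scope ring_scope.

(* [x : clifford R r] is \sum_A x A *: e_A, where e_A is the increasing product
   of the e_i with i in A. *)
Definition clifford (R : realType) (r : nat) : Type := {ffun {set 'I_r} -> R}.

HB.instance Definition _ (R : realType) (r : nat) :=
  GRing.Lmodule.on (clifford R r).
HB.instance Definition _ (R : realType) (r : nat) := Choice.on (clifford R r).

Section Clifford.
Context {R : realType} {r : nat}.
Local Notation Cl := (clifford R r).
Implicit Types (A B C : {set 'I_r}) (a b c : Cl).

Definition symdiff A B : {set 'I_r} :=
  [set i | (i \in A) (+) (i \in B)]%SET.

(* e_A e_B = clsign A B *: e_(symdiff A B): sorting the product costs a factor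
   -1 for each (i, j) in A x B with j < i, and e_i ^+ 2 = -1 one for each i
   in both A and B. *)
Definition clsign A B : R :=
  \prod_(i < r) \prod_(j < r) (-1) ^+ [&& i \in A, j \in B & (j <= i)%N].

Definition cl_basis A : Cl := [ffun B => (A == B)%:R].

Definition cl_mul a b : Cl :=
  \sum_(A : {set 'I_r}) \sum_(B : {set 'I_r})
    (a A * b B * clsign A B) *: cl_basis (symdiff A B).

Lemma symdiffA : associative symdiff.
Proof. by move=> A B C; apply/setP => i; rewrite !inE addbA. Qed.

Lemma symdiff0s : left_id finset.set0 symdiff.
Proof. by move=> A; apply/setP => i; rewrite !inE. Qed.

Lemma symdiffs0 : right_id finset.set0 symdiff.
Proof. by move=> A; apply/setP => i; rewrite !inE addbF. Qed.

Lemma clsignDl A B C : clsign (symdiff A B) C = clsign A C * clsign B C.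
Proof.
rewrite -big_split; apply: eq_bigr => i _ /=; rewrite -big_split.
apply: eq_bigr => j _ /=; rewrite !inE.
by case: (i \in A); case: (i \in B); case: (j \in C); case: (j <= i)%N;
  rewrite /= ?expr0 ?expr1 ?mulr1 ?mul1r ?mulrNN ?mulr1.
Qed.

Lemma clsignDr A B C : clsign A (symdiff B C) = clsign A B * clsign A C.
Proof.
rewrite -big_split; apply: eq_bigr => i _ /=; rewrite -big_split.
apply: eq_bigr => j _ /=; rewrite !inE.
by case: (i \in A); case: (j \in B); case: (j \in C); case: (j <= i)%N;
  rewrite /= ?expr0 ?expr1 ?mulr1 ?mul1r ?mulrNN ?mulr1.
Qed.

Lemma clsign0s A : clsign finset.set0 A = 1.
Proof. by rewrite /clsign big1 // => i _; rewrite big1 // => j _; rewrite !inE. Qed.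

Lemma clsigns0 A : clsign A finset.set0 = 1.
Proof.
by rewrite /clsign big1 // => i _; rewrite big1 // => j _; rewrite !inE andbF.
Qed.

Lemma cl_expand a : a = \sum_A (a A *: cl_basis A : Cl).
Proof.
apply/ffunP => B; rewrite sum_ffunE (bigD1 B) //= big1 => [|A /negPf nAB].
  by rewrite !ffunE eqxx addr0 [RHS]mulr1.
by rewrite !ffunE nAB [LHS]mulr0.
Qed.

Lemma cl_mulDl : left_distributive cl_mul +%R.
Proof.
move=> a b c; rewrite -big_split; apply: eq_bigr => A _ /=.
rewrite -big_split; apply: eq_bigr => B _ /=.
by rewrite ffunE -scalerDl !mulrDl.
Qed.

Lemma cl_mulDr : right_distributive cl_mul +%R.
Proof.
move=> a b c; rewrite -big_split; apply: eq_bigr => A _ /=.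
rewrite -big_split; apply: eq_bigr => B _ /=.
by rewrite ffunE -scalerDl mulrDr mulrDl.
Qed.

Lemma cl_mulZl k a b : cl_mul (k *: a) b = k *: cl_mul a b.
Proof.
rewrite scaler_sumr; apply: eq_bigr => A _; rewrite scaler_sumr.
by apply: eq_bigr => B _; rewrite ffunE scalerA !mulrA.
Qed.

Lemma cl_mulZr k a b : cl_mul a (k *: b) = k *: cl_mul a b.
Proof.
rewrite scaler_sumr; apply: eq_bigr => A _; rewrite scaler_sumr.
by apply: eq_bigr => B _; rewrite ffunE scalerA !mulrA (mulrC (a A)).
Qed.

Lemma cl_mul_basis A B :
  cl_mul (cl_basis A) (cl_basis B) = clsign A B *: cl_basis (symdiff A B).
Proof.
rewrite /cl_mul (bigD1 A) //= [X in _ + X]big1 => [|A' /negPf nA].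
  rewrite (bigD1 B) //= [X in _ + X + _]big1 => [|B' /negPf nB].
    by rewrite !ffunE !eqxx !mul1r !addr0.
  by rewrite !ffunE (eq_sym B) nB mulr0 mul0r scale0r.
by rewrite big1 // => B' _; rewrite !ffunE (eq_sym A) nA !mul0r scale0r.
Qed.

Lemma cl_mul0l a : cl_mul 0 a = 0.
Proof. by rewrite -[X in cl_mul X _](scale0r (0 : Cl)) cl_mulZl scale0r. Qed.

Lemma cl_mul0r a : cl_mul a 0 = 0.
Proof. by rewrite -[X in cl_mul _ X](scale0r (0 : Cl)) cl_mulZr scale0r. Qed.

Lemma cl_mul_suml (I : finType) (F : I -> Cl) b :
  cl_mul (\sum_i F i) b = \sum_i cl_mul (F i) b.
Proof.
exact: (big_morph (cl_mul^~ b) (fun x y => cl_mulDl x y b) (cl_mul0l b)).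
Qed.

Lemma cl_mul_sumr (I : finType) (F : I -> Cl) b :
  cl_mul b (\sum_i F i) = \sum_i cl_mul b (F i).
Proof. exact: (big_morph (cl_mul b) (cl_mulDr b) (cl_mul0r b)). Qed.

Lemma cl_mul_expandl a b : cl_mul a b = \sum_A a A *: cl_mul (cl_basis A) b.
Proof.
rewrite {1}(cl_expand a) (cl_mul_suml (fun A => a A *: cl_basis A : Cl)).
by apply: eq_bigr => A _; rewrite cl_mulZl.
Qed.

Lemma cl_mul_expandr a b : cl_mul a b = \sum_A b A *: cl_mul a (cl_basis A).
Proof.
rewrite {1}(cl_expand b) (cl_mul_sumr (fun A => b A *: cl_basis A : Cl)).
by apply: eq_bigr => A _; rewrite cl_mulZr.
Qed.

Lemma cl_mul_basisA A B C :
  cl_mul (cl_basis A) (cl_mul (cl_basis B) (cl_basis C)) =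
  cl_mul (cl_mul (cl_basis A) (cl_basis B)) (cl_basis C).
Proof.
rewrite !(cl_mulZl, cl_mulZr, cl_mul_basis) !scalerA symdiffA.
by rewrite clsignDl clsignDr mulrC mulrAC -mulrA [_ * clsign B C]mulrC mulrA.
Qed.

Lemma cl_mulA : associative cl_mul.
Proof.
move=> a b c; rewrite [LHS]cl_mul_expandl (cl_mul_expandl a b).
rewrite (cl_mul_suml (fun A => a A *: cl_mul (cl_basis A) b)).
apply: eq_bigr => A _; rewrite cl_mulZl; congr (_ *: _).
rewrite (cl_mul_expandl b) (cl_mul_expandr _ b).
rewrite (cl_mul_suml (fun B => b B *: cl_mul (cl_basis A) (cl_basis B))).
rewrite (cl_mul_sumr (fun B => b B *: cl_mul (cl_basis B) c)).
apply: eq_bigr => B _; rewrite cl_mulZl cl_mulZr; congr (_ *: _).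
rewrite (cl_mul_expandr _ c) [RHS]cl_mul_expandr.
rewrite (cl_mul_sumr (fun C => c C *: cl_mul (cl_basis B) (cl_basis C))).
by apply: eq_bigr => C _; rewrite cl_mulZr cl_mul_basisA.
Qed.

Lemma cl_mul1l : left_id (cl_basis finset.set0) cl_mul.
Proof.
move=> a; rewrite cl_mul_expandr [RHS]cl_expand; apply: eq_bigr => A _.
by rewrite cl_mul_basis symdiff0s clsign0s scale1r.
Qed.

Lemma cl_mul1r : right_id (cl_basis finset.set0) cl_mul.
Proof.
move=> a; rewrite cl_mul_expandl [RHS]cl_expand; apply: eq_bigr => A _.
by rewrite cl_mul_basis symdiffs0 clsigns0 scale1r.
Qed.

Lemma cl_1neq0 : cl_basis finset.set0 != 0.
Proof.
apply/eqP => /ffunP /(_ finset.set0); rewrite !ffunE eqxx => /eqP.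
by rewrite oner_eq0.
Qed.

HB.instance Definition _ := GRing.Zmodule_isNzRing.Build (clifford R r)
  cl_mulA cl_mul1l cl_mul1r cl_mulDl cl_mulDr cl_1neq0.
HB.instance Definition _ := GRing.Lmodule_isLalgebra.Build R (clifford R r)
  (fun k a b => esym (cl_mulZl k a b)).
HB.instance Definition _ := GRing.Lalgebra_isAlgebra.Build R (clifford R r)
  (fun k a b => esym (cl_mulZr k a b)).

Definition cl_gen (i : 'I_r) : Cl := cl_basis [set i]%SET.

Lemma clsign11 (i j : 'I_r) :
  clsign [set i]%SET [set j]%SET = (-1) ^+ (j <= i)%N.
Proof.
rewrite /clsign (bigD1 i) //= [X in _ * X]big1 => [|k /negPf nk].
  rewrite (bigD1 j) //= [X in _ * X * _]big1 => [|k /negPf nk].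
    by rewrite !inE !eqxx !mulr1.
  by rewrite !inE nk andbF.
by rewrite big1 // => l _; rewrite !inE nk.
Qed.

Lemma cl_gen_rel (i j : 'I_r) :
  cl_gen i * cl_gen j + cl_gen j * cl_gen i = (- (2 *+ (i == j)))%:A.
Proof.
have E (k l : 'I_r) : cl_gen k * cl_gen l =
    (-1) ^+ (l <= k)%N *: cl_basis (symdiff [set k]%SET [set l]%SET).
  by rewrite -clsign11 -cl_mul_basis.
have S : symdiff [set j]%SET [set i]%SET = symdiff [set i]%SET [set j]%SET.
  by apply/setP => k; rewrite !inE addbC.
rewrite !E S -scalerDl; have [<-|nij] := eqVneq i j.
  have -> : symdiff [set i]%SET [set i]%SET = finset.set0.
    by apply/setP => k; rewrite !inE addbb.
  by rewrite leqnn expr1 -opprD.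
rewrite mulr0n oppr0 scale0r.
case: (ltngtP i j) => [_|_|/val_inj eij]; last by rewrite eij eqxx in nij.
- by rewrite expr0 expr1 addrN scale0r.
- by rewrite expr0 expr1 addNr scale0r.
Qed.

Definition cl_even : set Cl := [set a | forall A, odd #|A| -> a A = 0].

(* Endomorphisms of R^n are matrices acting on column vectors. A representation
   of the even subalgebra is given by a map on [clifford R r] whose values
   outside [cl_even] are irrelevant. *)
Record even_rep (n : nat) (rho : Cl -> 'M[R]_n) : Prop := EvenRep {
  even_rep_linear : forall k a b, cl_even a -> cl_even b ->
    rho (k *: a + b) = k *: rho a + rho b;
  even_rep1 : rho 1 = 1%:M;
  even_repM : forall a b, cl_even a -> cl_even b ->
    rho (a * b) = rho a *m rho b }.

Definition irreducible_rep (n : nat) (rho : Cl -> 'M[R]_n) : Prop :=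
  (0 < n)%N /\
  forall W : {vspace 'cV[R]_n},
    (forall a v, cl_even a -> v \in W -> rho a *m v \in W) ->
    W = 0%VS \/ W = fullv.

Definition equivalent_rep (n : nat) (rho sigma : Cl -> 'M[R]_n) : Prop :=
  exists2 P, P \in unitmx &
    forall a, cl_even a -> P *m rho a = sigma a *m P.

(* [rho] is isomorphic to the direct sum of the [sigma k], the isomorphism
   being the sum of the intertwiners [P k]. *)
Definition is_direct_sum (n d m : nat) (rho : Cl -> 'M[R]_n)
    (sigma : 'I_m -> Cl -> 'M[R]_d) : Prop :=
  exists P : 'I_m -> 'M[R]_(n, d),
    (forall k a, cl_even a -> rho a *m P k = P k *m sigma k a) /\
    bijective (fun w : {ffun 'I_m -> 'cV[R]_d} => \sum_k P k *m w k).

(* [g] is the Gram matrix of the inner product. *)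
Definition linear_even_clifford (n : nat) (g : 'M[R]_n) (rho : Cl -> 'M[R]_n) :
    Prop :=
  even_rep rho /\
  forall i j : 'I_r, (i < j)%N ->
    let J := rho (cl_gen i * cl_gen j) in
    J^T *m g = - (g *m J) /\ J *m J = - 1%:M.

End Clifford.

(* The dimension d_r of the irreducible real representations of the even
   Clifford algebra of rank r. *)
Definition spinor_dim (r : nat) : nat :=
  match (r %% 8)%N with
  | 1%N | 7%N => (2 ^ ((r - 1) %/ 2))%N
  | 2%N | 4%N | 6%N => (2 ^ (r %/ 2))%N
  | 3%N | 5%N => (2 ^ ((r + 1) %/ 2))%N
  | _ => (2 ^ (r %/ 2 - 1))%N
  end.

Section Smooth.
Context {R : realType} {V W : normedModType R}.

(* Only meant for open [U]. *)
Fixpoint Ck (k : nat) (U : set V) (f : V -> W) : Prop :=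
  match k with
  | 0%N => forall x, U x -> {for x, continuous f}
  | k'.+1 => (forall x, U x -> differentiable f x) /\
             forall v, Ck k' U (fun x => 'D_v f x)
  end.

Definition smooth_on (U : set V) (f : V -> W) : Prop := forall k, Ck k U f.

End Smooth.

Record chart (R : realType) (M : topologicalType) (n : nat) := Chart {
  dom : set M;
  coord : M -> 'rV[R]_n;
  point_of : 'rV[R]_n -> M;
  dom_open : open dom;
  coord_open : open (coord @` dom);
  coordK : forall p, dom p -> point_of (coord p) = p;
  coord_continuous : forall p, dom p -> {for p, continuous coord};
  point_of_continuous :
    forall x, (coord @` dom) x -> {for x, continuous point_of} }.

Record manifold (R : realType) (n : nat) := Manifold {
  points :> topologicalType;
  index : Type;
  chart_of : index -> chart R points n;
  manifold_hausdorff : hausdorff_space points;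
  manifold_second_countable : @second_countable points;
  manifold_cover : forall p, exists i, dom (chart_of i) p;
  manifold_transition : forall i j,
    smooth_on (coord (chart_of i) @` (dom (chart_of i) `&` dom (chart_of j)))
              (coord (chart_of j) \o point_of (chart_of i)) }.

Section Manifold.
Context {R : realType} {n : nat} (M : manifold R n).
Local Notation dm i := (dom (chart_of (i : index M))).
Local Notation co i := (coord (chart_of (i : index M))).
Local Notation pt i := (point_of (chart_of (i : index M))).

Definition smooth_map (phi : M -> M) : Prop :=
  continuous phi /\
  forall i j, smooth_on (co i @` (dm i `&` phi @^-1` dm j))
                        (co j \o phi \o pt i).

(* The matrix, acting on columns, of the differential of [phi] at [p] in the
   charts [i] at [p] and [j] at [phi p]. [jacobian] acts on rows. *)
Definition diff_mx (phi : M -> M) (i j : index M) (p : M) : 'M[R]_n :=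
  (jacobian (co j \o phi \o pt i) (co i p))^T.

(* Tensors at [p] are given by their components in each chart around [p]; the
   values outside the domains of the charts are irrelevant. *)
Definition in_charts (phi : M -> M)
    (P : index M -> index M -> M -> 'M[R]_n -> Prop) : Prop :=
  forall i j p, dm i p -> dm j (phi p) -> P i j p (diff_mx phi i j p).

Definition vector_field := index M -> M -> 'cV[R]_n.

Definition bilinear_invariant (g : index M -> M -> 'M[R]_n) (phi : M -> M) :=
  in_charts phi (fun i j p D => D^T *m g j (phi p) *m D = g i p).

Definition endo_space_invariant (Q : index M -> M -> set 'M[R]_n)
    (phi : M -> M) :=
  in_charts phi (fun i j p D =>
    Q j (phi p) = [set D *m A *m invmx D | A in Q i p]).

(* Invariance under the identity is the change of charts rule. *)
Record riemannian_metric := RiemannianMetric {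
  metric :> index M -> M -> 'M[R]_n;
  metric_tensor : bilinear_invariant metric id;
  metric_sym : forall i p, dm i p -> (metric i p)^T = metric i p;
  metric_pos : forall i p (v : 'cV[R]_n), dm i p -> v != 0 ->
    0 < (v^T *m metric i p *m v) 0 0;
  metric_smooth : forall i, smooth_on (co i @` dm i) (metric i \o pt i) }.

(* A smooth family of linear structures on the tangent spaces over [U], in the
   chart [i], with Q the span of the J_ij = rho (e_i e_j). *)
Record local_even_clifford (r : nat) (g : riemannian_metric)
    (Q : index M -> M -> set 'M[R]_n) (i : index M) (U : set M)
    (rho : M -> clifford R r -> 'M[R]_n) : Prop := LocalEvenClifford {
  local_open : open U;
  local_dom : U `<=` dm i;
  local_linear : forall q, U q -> linear_even_clifford (g i q) (rho q);
  local_smooth : forall k l : 'I_r, (k < l)%N ->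
    smooth_on (co i @` U) (fun x => rho (pt i x) (cl_gen k * cl_gen l));
  local_span : forall q, U q -> Q i q =
    [set A | exists a : 'I_r -> 'I_r -> R, A =
      \sum_(k < r) \sum_(l < r | (k < l)%N)
        a k l *: rho q (cl_gen k * cl_gen l)] }.

Record even_clifford_structure (r : nat) (g : riemannian_metric) :=
  EvenCliffordStructure {
    spin_bundle : index M -> M -> set 'M[R]_n;
    spin_bundle_tensor : endo_space_invariant spin_bundle id;
    spin_bundle_local : forall i p, dm i p ->
      exists (U : set M) (rho : M -> clifford R r -> 'M[R]_n),
        U p /\ local_even_clifford g spin_bundle i U rho }.

Section Structure.
Context {r : nat} {g : riemannian_metric} (S : even_clifford_structure r g).

(* Only the span of the J_ij being part of the structure, the multiplicities are
   those of suitable local J_ij: for 4 %| r, replacing e_1 by - e_1 keeps the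
   span and exchanges the two representations. *)
Definition locally_of_type (T : (clifford R r -> 'M[R]_n) -> Prop) : Prop :=
  forall i p, dm i p ->
    exists (U : set M) (rho : M -> clifford R r -> 'M[R]_n),
      [/\ U p, local_even_clifford g (spin_bundle S) i U rho &
          forall q, U q -> T (rho q)].

Definition has_multiplicity (m : nat) : Prop :=
  exists delta : clifford R r -> 'M[R]_(spinor_dim r),
    [/\ even_rep delta, irreducible_rep delta &
        locally_of_type (fun rho => is_direct_sum rho (fun _ : 'I_m => delta))].

Definition has_multiplicities (m1 m2 : nat) : Prop :=
  exists delta1 delta2 : clifford R r -> 'M[R]_(spinor_dim r),
    [/\ even_rep delta1 /\ irreducible_rep delta1,
        even_rep delta2 /\ irreducible_rep delta2,
        ~ equivalent_rep delta1 delta2 &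
        locally_of_type (fun rho => is_direct_sum rho
          (fun k : 'I_(m1 + m2) => if (k < m1)%N then delta1 else delta2))].

Definition Aut : set (M -> M) :=
  [set phi | [/\ smooth_map phi,
                 exists psi, [/\ smooth_map psi, cancel phi psi & cancel psi phi],
                 bilinear_invariant g phi &
                 endo_space_invariant (spin_bundle S) phi]].

Record one_parameter_subgroup (phi : R -> M -> M) : Prop :=
  OneParameterSubgroup {
    flow_Aut : forall t, Aut (phi t);
    flow0 : phi 0 = id;
    flowD : forall s t, phi (s + t) = phi s \o phi t;
    flow_continuous : continuous (fun z : R * M => phi z.1 z.2);
    flow_smooth : forall i j,
      smooth_on
        [set z : R^o * 'rV[R]_n | (co i @` dm i) z.2 /\
                                  dm j (phi z.1 (pt i z.2))]
        (fun z => co j (phi z.1 (pt i z.2))) }.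

(* The Lie algebra of Aut(M), as the generators of one-parameter subgroups. *)
Definition aut : set vector_field :=
  [set X | exists2 phi, one_parameter_subgroup phi &
    forall i p, dm i p ->
      X i p = (derive1 (fun t : R => co i (phi t p)) 0)^T].

Definition lin_indep (k : nat) (X : 'I_k -> vector_field) : Prop :=
  forall a : 'I_k -> R,
    (forall i p, dm i p -> \sum_(l < k) a l *: X l i p = 0) ->
    forall l, a l = 0.

(* The dimension of the Lie group Aut(M), i.e. of its Lie algebra. *)
Definition dim_Aut : \bar R :=
  ereal_sup [set (k%:R)%:E | k in [set k : nat |
    exists X : 'I_k -> vector_field, (forall l, aut (X l)) /\ lin_indep X]].

End Structure.
End Manifold.

Definition dmax (r m : nat) : nat :=
  (match r %% 8 with
   | 1 | 7 => 'C(m, 2)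
   | 2 | 6 => m ^ 2
   | _ => 'C(2 * m + 1, 2)
   end + 'C(r, 2) + spinor_dim r * m)%N.

Definition dmax2 (r m1 m2 : nat) : nat :=
  (match r %% 8 with
   | 0 => 'C(m1, 2) + 'C(m2, 2)
   | _ => 'C(2 * m1 + 1, 2) + 'C(2 * m2 + 1, 2)
   end + 'C(r, 2) + spinor_dim r * (m1 + m2))%N.

(* Main.v *)
(* A vector field X generated by automorphisms satisfies the Killing equation
   and the infinitesimal form of the invariance of Q, both linear in X.
   Differentiating the Killing equation expresses the second derivatives of X
   through its 1-jet, so by Gronwall's inequality and connectedness X is determined
   by its 1-jet at a point p. The values X(p) contribute at most N dimensions.
   If X(p) = 0, then A = DX(p) is skew and [A, Q] is contained in Q. Averaging A
   over the finite group of the elements +e_I and -e_I, I even, splits A into an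
   element of Q, of dimension at most binom(r, 2), and a skew endomorphism commuting
   with the even Clifford algebra. The latter form the image of an explicit
   projection, whose trace is a sum over even I of squares of characters and of the
   signs of e_I^2. The character vanishes except at e_I = 1 and, for r even, at the
   volume element; for 4 | r the volume element acts on the two irreducible
   representations by opposite signs. *)
Require Import Defs.
From HB Require Import structures.
From mathcomp Require Import all_boot all_order all_algebra.
From mathcomp Require Import all_classical all_reals all_analysis.
From mathcomp Require Import perm ring lra zify.

Set Implicit Arguments.
Unset Strict Implicit.
Unset Printing Implicit Defensive.

Import Order.TTheory GRing.Theory Num.Theory numFieldNormedType.Exports.

Local Open Scope classical_set_scope.
Local Open Scope ring_scope.

(** * Signs of the Clifford basis *)

(** The centralizers so(m), u(m), sp(m) of the spinor representations never appear. The skew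
    commutant is the range of an idempotent, so its dimension is a trace, and the real, complex or
    quaternionic type of the representation enters only through the sum of the signs of e_I^2 over
    even I. This sum is the real part of (1 + i)^r, which is the source of the dependence on r mod
    8. For r = 2, 6 mod 8 the volume element squares to -1, so the square of its character enters
    with a negative sign, and dropping it gives m^2. On the manifold the difficulty is that Q varies
    with the point and is known only as a span. Membership in Q at a fixed point p is therefore
    written as a linear equation, the J_ij along a flow line are pulled back to p, and the equation
    is differentiated at time 0. *)

Section EvenSets.
Context {R : realType} {r : nat}.
Implicit Types A B : {set 'I_r}.

Definition even_set A := ~~ odd #|A|.

Lemma symdiffE A B : symdiff A B = ((A :\: B) :|: (B :\: A))%SET.
Proof. by apply/setP => i; rewrite !inE; case: (i \in A); case: (i \in B). Qed.

Lemma symdiffss A : symdiff A A = finset.set0.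
Proof. by apply/setP => i; rewrite !inE addbb. Qed.

Lemma card_symdiff A B :
  (#|symdiff A B| + 2 * #|(A :&: B)%SET| = #|A| + #|B|)%N.
Proof.
rewrite symdiffE cardsU [X in (_ - #|pred_of_set X|)%N](_ : _ = finset.set0).
  have := cardsID B A; have := cardsID A B; rewrite finset.setIC cards0; lia.
by apply/setP => i; rewrite !inE; case: (i \in A); case: (i \in B).
Qed.

Lemma odd_symdiff A B : odd #|symdiff A B| = odd #|A| (+) odd #|B|.
Proof.
by rewrite -oddD -card_symdiff oddD mul2n odd_double addbF.
Qed.

Lemma even_symdiff A B : even_set A -> even_set B -> even_set (symdiff A B).
Proof. by rewrite /even_set odd_symdiff => /negPf-> /negPf->. Qed.

Lemma even_set0 : even_set finset.set0.
Proof. by rewrite /even_set cards0. Qed.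

Lemma symdiff1 (i j : 'I_r) : i != j ->
  symdiff [set i]%SET [set j]%SET = [set i; j]%SET.
Proof.
move=> nij; apply/setP => k; rewrite !inE.
by case: (eqVneq k i) => [->|]; rewrite ?(negPf nij).
Qed.

Lemma even_pair (i j : 'I_r) : even_set (symdiff [set i]%SET [set j]%SET).
Proof. by rewrite /even_set odd_symdiff !cards1. Qed.

(** The products e_i e_j generate the even subalgebra: a nonempty even set can lose two elements and
    stays even. Properties of e_A that are multiplicative in A need checking only for pairs i < j,
    where the hypotheses on J_ij apply. *)
Lemma even_set_ind (P : {set 'I_r} -> Prop) : P finset.set0 ->
  (forall (i j : 'I_r) A, (i < j)%N -> even_set A -> P A ->
     P (symdiff (symdiff [set i]%SET [set j]%SET) A)) ->
  forall A, even_set A -> P A.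
Proof.
move=> P0 PS A; move: {2}#|A| (leqnn #|A|) => m.
elim: m A => [|m IH] A.
  by rewrite leqn0 cards_eq0 => /eqP->.
move=> Am eA; have [->//|/set0Pn[i iA]] := eqVneq A finset.set0.
have cA : #|A| = #|(A :\ i)%SET|.+1 by rewrite (cardsD1 i) iA.
have /set0Pn[j jA] : (A :\ i)%SET != finset.set0.
  apply/eqP => e; move: eA; rewrite /even_set cA e cards0 //.
have cA' : #|(A :\ i)%SET| = #|(A :\ i :\ j)%SET|.+1 by rewrite (cardsD1 j) jA.
have nij : i != j by move: jA; rewrite !inE eq_sym => /andP[].
have eB : even_set (A :\ i :\ j)%SET.
  by move: eA; rewrite /even_set cA cA' /= negbK.
have PB : P (A :\ i :\ j)%SET by apply: IH => //; lia.
have EA k l : [set k; l]%SET = [set i; j]%SET ->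
    k != l -> symdiff (symdiff [set k]%SET [set l]%SET) (A :\ i :\ j)%SET = A.
  move=> ekl nkl; rewrite symdiff1 // ekl; apply/setP => x; rewrite !inE.
  have jA' : j \in A by move: jA; rewrite !inE => /andP[].
  case: (eqVneq x i) => [->|_]; first by rewrite iA andbF.
  by case: (eqVneq x j) => [->|_] //=; rewrite jA'.
case: (ltngtP i j) => [ij|ji|/val_inj e]; last by rewrite e eqxx in nij.
- by rewrite -(EA i j) //; apply: PS.
- by rewrite -(EA j i) 1?finset.setUC 1?eq_sym //; apply: PS.
Qed.

(** A pair (i, j) in A x B with i != j is counted by exactly one of the two signs, and a pair (i, i)
    by both. *)
Lemma clsign_swap A B :
  clsign A B * clsign B A = (-1) ^+ (#|A| * #|B| + #|(A :&: B)%SET|) :> R.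
Proof.
rewrite /clsign [X in _ * X]exchange_big -big_split /=.
under eq_bigr => i _.
  rewrite -big_split /=.
  under eq_bigr => j _.
    rewrite -exprD.
    rewrite (_ : (-1) ^+ _ = (-1) ^+ ((i \in A) * (j \in B) +
       (if j == i then (i \in A) && (j \in B) : nat else 0))%N); last first.
      rewrite eq_sym -val_eqE /=.
      by case: (i \in A); case: (j \in B); case: (ltngtP i j).
    over.
  rewrite prodrXr big_split /= -big_mkcond /= big_pred1_eq.
  over.
rewrite prodrXr big_split /=; congr (_ ^+ (_ + _)).
  under eq_bigr => i _ do rewrite -big_distrr /=.
  have cardE (C : {set 'I_r}) : #|C| = (\sum_i (i \in C))%N.
    by rewrite -sum1_card big_mkcond; apply: eq_bigr => i _; case: ifP.
  by rewrite -big_distrl /= -!cardE.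
rewrite -sum1_card [in RHS]big_mkcond; apply: eq_bigr => i _ /=.
by rewrite inE; case: ifP.
Qed.

Lemma clsign_sqr A B : clsign A B * clsign A B = 1 :> R.
Proof.
rewrite /clsign -big_split big1 // => i _; rewrite -big_split big1 // => j _.
by rewrite /= -expr2 sqrr_sign.
Qed.

Lemma clsign_neq0 A B : clsign A B != 0 :> R.
Proof.
by apply: contra_eqN (clsign_sqr A B) => /eqP->; rewrite mul0r eq_sym oner_eq0.
Qed.

(** With m the cardinality of A, sorting e_A e_A takes binom(m, 2) transpositions and leaves m
    squares e_i^2 = -1. The induction splits off one generator. *)
Lemma clsign_self A : clsign A A = (-1) ^+ 'C(#|A|.+1, 2) :> R.
Proof.
move: {2}#|A| (erefl #|A|) => m; elim: m A => [|m IH] A.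
  by move/cards0_eq ->; rewrite cards0 clsign0s.
move=> Am; have /set0Pn[i iA] : A != finset.set0 by rewrite -card_gt0 Am.
have cA : #|(A :\ i)%SET| = m by move: Am; rewrite (cardsD1 i) iA => -[].
have EA : A = symdiff [set i]%SET (A :\ i)%SET.
  by apply/setP => x; rewrite !inE; case: eqVneq => [->|].
rewrite {1 2}EA clsignDl !clsignDr clsign11 leqnn.
rewrite IH // cA Am; transitivity
  (- (clsign [set i]%SET (A :\ i)%SET * clsign (A :\ i)%SET [set i]%SET) *
   (-1) ^+ 'C(m.+1, 2) : R); first by ring.
rewrite clsign_swap cards1 cA mul1n.
rewrite (_ : ([set i] :&: (A :\ i) = finset.set0)%SET); last first.
  by apply/setP => x; rewrite !inE; case: eqVneq.
by rewrite cards0 addn0 [in RHS]binS bin1 [in RHS]exprD exprS; ring.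
Qed.

Lemma clsign_swap_even A B : even_set A ->
  clsign A B * clsign B A = (-1) ^+ #|(A :&: B)%SET| :> R.
Proof.
move=> eA; rewrite clsign_swap exprD -signr_odd oddM (negPf eA) expr0.
by rewrite mul1r.
Qed.

End EvenSets.

(** * Sums of signs over the even subsets *)

Section BinomialTransform.
Context {R : realType}.
Implicit Types u : nat -> R.

Definition binomial_transform r u : R := \sum_(k < r.+1) u k *+ 'C(r, k).

Lemma binomial_transformS r u : binomial_transform r.+1 u =
  binomial_transform r u + binomial_transform r (u \o succn).
Proof.
rewrite /binomial_transform big_ord_recl bin0.
under eq_bigr => i _ do rewrite /= /bump /= add1n binS mulrnDr.
rewrite big_split addrA /=; congr (_ + _).
rewrite big_ord_recr /= bin_small // mulr0n addr0 [in RHS]big_ord_recl bin0.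
by congr (_ + _); apply: eq_bigr => i _; rewrite /bump add1n.
Qed.

Lemma sum_set_card r u :
  \sum_(A : {set 'I_r}) u #|A| = binomial_transform r u.
Proof.
rewrite (partition_big (fun A : {set 'I_r} => inord #|A| : 'I_r.+1) xpredT) //=.
apply: eq_bigr => k _.
have E (A : {set 'I_r}) : (inord #|A| == k) = (#|A| == k :> nat).
  rewrite -val_eqE /= inordK // ltnS -[X in (_ <= X)%N]card_ord.
  exact: max_card.
rewrite (eq_bigr (fun=> u k)) => [|A]; last by rewrite E => /eqP->.
rewrite sumr_const -[X in 'C(X, _)]card_ord -card_draws; congr (_ *+ _).
by apply: eq_card => A; rewrite inE -E.
Qed.

Lemma eq_binomial_transform r u v : u =1 v ->
  binomial_transform r u = binomial_transform r v.
Proof. by move=> uv; apply: eq_bigr => k _; rewrite uv. Qed.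

Lemma card_even_sets r : 
  \sum_(A : {set 'I_r.+1} | even_set A) 1 = 2 ^+ r :> R.
Proof.
rewrite big_mkcond (sum_set_card _ (fun k => if ~~ odd k then 1 else 0)).
rewrite binomial_transformS -big_split /=.
rewrite -[2](_ : 1 + 1 = 2 :> R) // exprDn; apply: eq_bigr => k _.
by rewrite !expr1n mul1r /=; case: (odd k); rewrite /= mul0rn ?add0r ?addr0.
Qed.

(** For k even this is the sign of e_A^2 with A of cardinality k. It is the real part of i^k for
    every k, and the value 0 at odd k lets sums run over all subsets. *)
Definition even_sign (k : nat) : R := if odd k then 0 else (-1) ^+ 'C(k.+1, 2).

Lemma even_signSS k : even_sign k.+2 = - even_sign k.
Proof.
rewrite /even_sign /= negbK; case: ifP => [|ok]; first by rewrite oppr0.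
rewrite binS bin1 binS bin1 -addnA exprD.
by rewrite -[X in _ * X]signr_odd oddD /= ok /= expr1 mulrN1.
Qed.

(** By the binomial theorem this is the real part of (1 + i)^r. *)
Definition even_sign_sum r : R := binomial_transform r even_sign.

(** This is (1 + i)^4 = -4 in real terms. If [u k.+2 = - u k], two steps of Pascal's rule leave
    twice the transform of the shifted sequence, the analogue of (1 + i)^2 = 2 i; this is applied
    twice. *)
Lemma even_sign_sum4 r : even_sign_sum (r + 4) = - 4 * even_sign_sum r.
Proof.
have shift2 u s : (forall k, u k.+2 = - u k) ->
    binomial_transform s.+2 u = 2 * binomial_transform s (u \o succn).
  move=> uSS; rewrite !binomial_transformS addrA -[in RHS]mulr_natl.
  rewrite (@eq_binomial_transform s ((u \o succn) \o succn) (\- u)) //.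
  rewrite [binomial_transform s (\- u)](_ : _ = - binomial_transform s u).
    by ring.
  by rewrite /binomial_transform -sumrN; apply: eq_bigr => k _; rewrite mulNrn.
rewrite /even_sign_sum addn4 shift2; last exact: even_signSS.
rewrite shift2; last by move=> k; exact: even_signSS.
rewrite (@eq_binomial_transform _ _ (\- even_sign)); last first.
  by move=> k /=; exact: even_signSS.
rewrite mulrA [binomial_transform r _](_ : _ = - binomial_transform r even_sign).
  by ring.
by rewrite /binomial_transform -sumrN; apply: eq_bigr => k _; rewrite mulNrn.
Qed.

Lemma even_sign_sumE q s : even_sign_sum (4 * q + s) =
  (- 4) ^+ q * even_sign_sum s.
Proof.
elim: q => [|q IH]; first by rewrite muln0 mul1r.
rewrite (_ : 4 * q.+1 + s = 4 * q + s + 4)%N; last by lia.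
rewrite even_sign_sum4 IH exprS; ring.
Qed.

Lemma even_sign_sum_small : [/\ even_sign_sum 0 = 1, even_sign_sum 1 = 1,
  even_sign_sum 2 = 0 & even_sign_sum 3 = -2].
Proof.
rewrite /even_sign_sum /binomial_transform /even_sign.
split; rewrite !big_ord_recl !big_ord0 /= /bump /= ?binS ?bin0 ?bin1 ?bin0n /=;
  by ring.
Qed.

Lemma sum_clsign r :
  \sum_(A : {set 'I_r} | even_set A) clsign A A = even_sign_sum r :> R.
Proof.
rewrite /even_sign_sum big_mkcond -sum_set_card; apply: eq_bigr => A _.
by rewrite /even_sign /even_set; case: odd => //=; rewrite clsign_self.
Qed.

End BinomialTransform.

(** * Representations of the even Clifford algebra *)

Section MatrixTraces.
Context {F : fieldType}.

(** In a full rank factorization M = C B, idempotence forces B C to be the identity, whose size is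
    the rank. *)
Lemma mxtrace_idempotent n (M : 'M[F]_n) : M *m M = M -> \tr M = (\rank M)%:R.
Proof.
move=> idM; move: (row_base_free M) (col_base_full M) (mulmx_base M).
move: (col_base M) (row_base M) => C B freeB fullC E.
have CBC : B *m C = 1%:M.
  apply: (row_free_inj freeB); apply: (row_full_inj fullC).
  by rewrite mul1mx !mulmxA E -mulmxA E idM.
by rewrite -{1}E mxtrace_mulC CBC mxtrace1.
Qed.

Lemma mxtrace_lin_mx m n (f : 'M[F]_(m, n) -> 'M[F]_(m, n)) :
  \tr (lin_mx f) = \sum_i \sum_j f (delta_mx i j) i j.
Proof.
rewrite /mxtrace (reindex _ (curry_mxvec_bij m n)) /= pair_big.
apply: eq_bigr => -[i j] _ /=.
by rewrite mxE /= -mxvec_delta mxvecK mxvecE.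
Qed.

(** In view of [mxtrace_lin_mx], this computes the trace of the operator X |-> L X K; the next lemma
    does the same for X |-> L X^T K. *)
Lemma sum_delta_mul m n (L : 'M[F]_m) (K : 'M[F]_n) :
  \sum_i \sum_j (L *m delta_mx i j *m K) i j = \tr L * \tr K.
Proof.
rewrite /mxtrace big_distrl; apply: eq_bigr => i _ /=.
rewrite big_distrr; apply: eq_bigr => j _ /=.
rewrite -mulmxA mxE (bigD1 i) //= big1 ?addr0 => [|k ki]; last first.
  by rewrite mxE big1 ?mulr0 // => l _; rewrite !mxE (negPf ki) mul0r.
rewrite mxE (bigD1 j) //= big1 ?addr0 => [|k kj].
  by rewrite !mxE !eqxx mul1r.
by rewrite mxE (negPf kj) andbF mul0r.
Qed.

Lemma sum_delta_mul_tr n (L K : 'M[F]_n) :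
  \sum_i \sum_j (L *m (delta_mx i j)^T *m K) i j = \tr (L *m K^T).
Proof.
rewrite /mxtrace; apply: eq_bigr => i _; rewrite mxE; apply: eq_bigr => j _.
rewrite trmx_delta -mulmxA mxE (bigD1 j) //= big1 ?addr0 => [|k ki]; last first.
  by rewrite mxE big1 ?mulr0 // => l _; rewrite !mxE (negPf ki) mul0r.
rewrite !mxE (bigD1 i) //= big1 ?addr0 => [|k kj].
  by rewrite !mxE !eqxx mul1r.
by rewrite mxE (negPf kj) andbF mul0r.
Qed.

End MatrixTraces.

Section EvenRep.
Context {R : realType} {r n : nat} (rho : clifford R r -> 'M[R]_n).
Hypothesis rho_rep : even_rep rho.
Implicit Types A B : {set 'I_r}.

Definition rep_basis A := rho (cl_basis A).
Local Notation J := rep_basis.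

Lemma cl_even_basis A : even_set A -> cl_even (cl_basis A : clifford R r).
Proof.
move=> eA B oB; rewrite ffunE; case: eqP => // AB.
by move: eA; rewrite /even_set AB oB.
Qed.

Lemma even_repE a : cl_even a ->
  rho a = \sum_(A | even_set A) a A *: J A.
Proof.
move=> ea; rewrite [in LHS](cl_expand a) (bigID (fun A => even_set A)) /=.
rewrite [X in _ + X]big1 ?addr0 => [|A]; last first.
  by rewrite negbK => oA; rewrite ea // scale0r.
have rho0 : rho 0 = 0.
  have := even_rep_linear rho_rep (-1) (a := 0) (b := 0).
  rewrite scaler0 addr0 scaleN1r addNr; apply => A _; exact: ffunE.
(* [rho] is linear on [cl_even] only, so the evenness of the partial sums is carried along with
   their images. *)
pose K (x : clifford R r) (y : 'M[R]_n) := cl_even x /\ rho x = y.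
suff [] : K (\sum_(A | even_set A) a A *: cl_basis A)
            (\sum_(A | even_set A) a A *: J A) by [].
elim/big_ind2: _ => [|x1 y1 x2 y2 [e1 <-] [e2 <-]|A eA].
- by split=> // A _; rewrite ffunE.
- split=> [A oA|]; first by rewrite ffunE e1 // e2 // addr0.
  by have := even_rep_linear rho_rep 1 e1 e2; rewrite !scale1r.
- have eb := cl_even_basis eA; split=> [B oB|].
    by rewrite ffunE eb // scaler0.
  have := even_rep_linear rho_rep (a A) eb (b := 0).
  by rewrite rho0 !addr0; apply => B _; rewrite ffunE.
Qed.

Lemma rep_basis0 : J finset.set0 = 1%:M.
Proof. exact: even_rep1. Qed.

Lemma rep_basisM A B : even_set A -> even_set B ->
  J A *m J B = clsign A B *: J (symdiff A B).
Proof.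
move=> eA eB; rewrite -(even_repM rho_rep); try exact: cl_even_basis.
have -> : cl_basis A * cl_basis B =
    clsign A B *: cl_basis (symdiff A B) :> clifford R r.
  exact: cl_mul_basis.
have eC := cl_even_basis (even_symdiff eA eB).
rewrite even_repE => [|C oC]; last by rewrite ffunE eC // scaler0.
rewrite (bigD1 (symdiff A B)) ?even_symdiff //= big1 ?addr0.
  by rewrite !ffunE eqxx; congr (_ *: _); exact: mulr1.
by move=> C /andP[_ nC]; rewrite !ffunE eq_sym (negPf nC) scaler0 scale0r.
Qed.

Lemma rep_basis_sqr A : even_set A -> J A *m J A = (clsign A A)%:M.
Proof. by move=> eA; rewrite rep_basisM // symdiffss rep_basis0 scalemx1. Qed.

Lemma rep_basis_swap A B : even_set A -> even_set B ->
  J A *m J B = (-1) ^+ #|(A :&: B)%SET| *: (J B *m J A).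
Proof.
move=> eA eB; rewrite !rep_basisM // scalerA -(clsign_swap_even B eA).
rewrite -mulrA clsign_sqr mulr1; congr (_ *: J _).
by apply/setP => i; rewrite !inE addbC.
Qed.

(** For i in A and j outside A, e_i e_j shares one index with A and therefore anticommutes with e_A.
    Conjugation by it changes the sign of the trace. *)
Lemma mxtrace_rep_basis A : even_set A -> A != finset.set0 ->
  A != finset.setT -> \tr (J A) = 0.
Proof.
move=> eA /set0Pn[i iA]; rewrite -finset.subTset => /subsetPn[j _ jA].
pose B := symdiff [set i]%SET [set j]%SET.
have nij : i != j by apply: contraNneq jA => <-.
have eB : even_set B by exact: even_pair.
have AB : (A :&: B)%SET = [set i]%SET.
  apply/setP => k; rewrite !inE; case: (eqVneq k i) => [->|].
    by rewrite iA (negPf nij).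
  by case: (eqVneq k j) => [->|_]; rewrite ?(negPf jA) ?andbF.
have := rep_basis_swap eA eB; rewrite AB cards1 expr1 scaleN1r => swap.
have : \tr (J A *m J B *m J B) = - \tr (J A *m J B *m J B).
  by rewrite {1}swap mulNmx raddfN /= -(mulmxA (J B)) mxtrace_mulC.
move/eqP; rewrite -subr_eq0 opprK -mulr2n mulrn_eq0 /=.
rewrite -mulmxA rep_basis_sqr // mul_mx_scalar mxtraceZ mulf_eq0.
by rewrite (negPf (clsign_neq0 _ _)) => /eqP.
Qed.

Lemma commute_even_rep A : even_set A ->
  (forall B, even_set B -> J A *m J B = J B *m J A) ->
  forall a, cl_even a -> J A *m rho a = rho a *m J A.
Proof.
move=> eA JA a ea; rewrite !even_repE // mulmx_sumr mulmx_suml.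
by apply: eq_bigr => B eB; rewrite -scalemxAr JA // scalemxAl.
Qed.

End EvenRep.

Lemma unitmx_injective (F : fieldType) n (T : 'M[F]_n) :
  (forall v : 'cV_n, T *m v = 0 -> v = 0) -> T \in unitmx.
Proof.
move=> injT; rewrite -unitmx_tr -row_free_unit -kermx_eq0; apply/rowV0P => v.
move=> /sub_kermxP vT; apply: trmx_inj; rewrite trmx0; apply: injT.
by apply: trmx_inj; rewrite trmx_mul trmxK vT trmx0.
Qed.

Section Averaging.
Context {R : realType} {r n1 n2 : nat}.
Variables (rho1 : clifford R r -> 'M[R]_n1) (rho2 : clifford R r -> 'M[R]_n2).
Hypotheses (rep1 : even_rep rho1) (rep2 : even_rep rho2).
Implicit Types (A B : {set 'I_r}) (X : 'M[R]_(n2, n1)).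
Local Notation J1 := (rep_basis rho1).
Local Notation J2 := (rep_basis rho2).

(* [clsign A A *: J1 A] is the inverse of [J1 A]. *)
Definition conj_basis A X := clsign A A *: (J2 A *m X *m J1 A).

Definition average X := \sum_(A | even_set A) conj_basis A X.

(** The signs produced on the two sides of X recombine into the one in the definition. The e_A
    multiply only up to sign, but their conjugations form an action of the group of even subsets
    under [symdiff]. *)
Lemma conj_basisM A B X : even_set A -> even_set B ->
  conj_basis A (conj_basis B X) = conj_basis (symdiff A B) X.
Proof.
move=> eA eB; rewrite /conj_basis -scalemxAr -scalemxAl scalerA !mulmxA.
rewrite rep_basisM // -!mulmxA rep_basisM // -!scalemxAl -!scalemxAr !scalerA.
rewrite (_ : symdiff B A = symdiff A B); last first.
  by apply/setP => i; rewrite !inE addbC.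
by congr (_ *: _); rewrite clsignDl !clsignDr; ring.
Qed.

Lemma conj_basis_sum A (I : finType) (P : pred I) (G : I -> 'M[R]_(n2, n1)) :
  conj_basis A (\sum_(i | P i) G i) = \sum_(i | P i) conj_basis A (G i).
Proof. by rewrite /conj_basis mulmx_sumr mulmx_suml scaler_sumr. Qed.

Lemma conj_basis_fixed A X : even_set A ->
  conj_basis A X = X <-> J2 A *m X = X *m J1 A.
Proof.
move=> eA; split=> [{1}<-|E].
  rewrite /conj_basis -scalemxAr !mulmxA rep_basis_sqr // mul_scalar_mx.
  by rewrite -scalemxAl scalerA clsign_sqr scale1r.
rewrite /conj_basis E -mulmxA rep_basis_sqr // mul_mx_scalar scalerA.
by rewrite clsign_sqr scale1r.
Qed.

(** Translation by A permutes the even subsets, so conjugation by e_A permutes the terms of the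
    average. *)
Lemma average_intertwines X A : even_set A ->
  J2 A *m average X = average X *m J1 A.
Proof.
move=> eA; apply/(conj_basis_fixed _ eA); rewrite conj_basis_sum.
have symK : involutive (symdiff A).
  by move=> B; rewrite symdiffA symdiffss symdiff0s.
rewrite /average [RHS](reindex_inj (inv_inj symK)) /=.
rewrite [RHS](eq_bigl even_set) => [|B]; last first.
  by rewrite /even_set odd_symdiff; move: eA; rewrite /even_set => /negPf->.
by apply: eq_bigr => B eB; rewrite conj_basisM.
Qed.

Lemma average_intertwines_rep X a : cl_even a ->
  rho2 a *m average X = average X *m rho1 a.
Proof.
move=> ea; rewrite (even_repE rep1) // (even_repE rep2) //.
rewrite mulmx_suml mulmx_sumr; apply: eq_bigr => A eA.
by rewrite -scalemxAl average_intertwines // scalemxAr.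
Qed.

Lemma sum_delta_average :
  \sum_i \sum_j average (delta_mx i j) i j =
  \sum_(A | even_set A) clsign A A * (\tr (J2 A) * \tr (J1 A)).
Proof.
under eq_bigr => i _ do under eq_bigr => j _ do rewrite summxE.
under eq_bigr => i _ do rewrite exchange_big.
rewrite exchange_big /=; apply: eq_bigr => A eA.
rewrite -sum_delta_mul mulr_sumr; apply: eq_bigr => i _.
by rewrite mulr_sumr; apply: eq_bigr => j _; rewrite mxE.
Qed.

End Averaging.

Section Irreducible.
Context {R : realType} {r d : nat}.
Implicit Types (delta : clifford R r -> 'M[R]_d) (A : {set 'I_r}).

(** Schur's lemma in terms of a stable kernel, a form that covers both an endomorphism of [delta]
    and an intertwiner towards another representation. *)
Lemma irreducible_ker delta (T : 'M[R]_d) : irreducible_rep delta ->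
  (forall a (v : 'cV_d), cl_even a -> T *m v = 0 -> T *m (delta a *m v) = 0) ->
  T = 0 \/ (forall v : 'cV_d, T *m v = 0 -> v = 0).
Proof.
move=> [_ irr] stab.
have memW v : (v \in lker (linfun (mulmx T : 'cV_d -> 'cV_d))) = (T *m v == 0).
  by rewrite memv_ker lfunE.
have [a v ea|W0|Wf] := irr (lker (linfun (mulmx T : 'cV_d -> 'cV_d))).
- by rewrite !memW => /eqP Tv; rewrite stab.
- by right=> v /eqP; rewrite -memW W0 memv0 => /eqP.
- left; apply/matrixP => i j.
  have := memvf (delta_mx j 0 : 'cV[R]_d); rewrite -Wf memW => /eqP/matrixP.
  move=> /(_ i 0); rewrite !mxE => <-.
  rewrite (bigD1 j) //= big1 => [|k kj]; first by rewrite mxE !eqxx mulr1 addr0.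
  by rewrite mxE (negPf kj) mulr0.
Qed.

(** Since e_A^2 = 1, the product of e_A - 1 and e_A + 1 vanishes. The factor e_A - 1 is zero or
    injective by Schur's lemma, and in the second case e_A + 1 = 0. The eigenvalues are thus real
    from the start. *)
Lemma central_basis_irreducible delta A : even_rep delta ->
  irreducible_rep delta -> even_set A -> clsign A A = 1 :> R ->
  (forall B, even_set B -> rep_basis delta A *m rep_basis delta B =
     rep_basis delta B *m rep_basis delta A) ->
  rep_basis delta A = 1%:M \/ rep_basis delta A = - 1%:M.
Proof.
move=> rep irr eA sA cA.
have [a v ea|/eqP|inj] := irreducible_ker (T := rep_basis delta A - 1%:M) irr.
- move=> Tv; rewrite mulmxA mulmxBl (commute_even_rep rep eA cA) // mul1mx.
  by rewrite -[X in _ - X]mulmx1 -mulmxBr -mulmxA Tv mulmx0.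
- by rewrite subr_eq0 => /eqP; left.
right; apply/eqP; rewrite -subr_eq0 opprK; apply/eqP/matrixP => i j.
have TU : (rep_basis delta A - 1%:M) *m (rep_basis delta A + 1%:M) = 0.
  rewrite mulmxBl mul1mx mulmxDr (rep_basis_sqr rep) // sA mulmx1.
  by rewrite [rep_basis _ _ + _]addrC subrr.
have := inj ((rep_basis delta A + 1%:M) *m delta_mx j 0).
by rewrite mulmxA TU mul0mx -colE => /(_ erefl)/matrixP/(_ i 0); rewrite !mxE.
Qed.

(** Orthogonality of characters: the sum is the trace of the averaging operator. An average is an
    intertwiner, hence zero or injective, and an injective one would be an equivalence because both
    representations have dimension d. *)
Lemma inequivalent_trace delta1 delta2 : even_rep delta1 -> even_rep delta2 ->
  irreducible_rep delta1 -> irreducible_rep delta2 ->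
  ~ equivalent_rep delta1 delta2 ->
  \sum_(A | even_set A) clsign A A *
    (\tr (rep_basis delta2 A) * \tr (rep_basis delta1 A)) = 0.
Proof.
move=> rep1 rep2 irr1 irr2 neq; rewrite -sum_delta_average.
rewrite big1 // => i _; rewrite big1 // => j _.
suff -> : average delta1 delta2 (delta_mx i j) = 0 by rewrite mxE.
set T := average _ _ _.
have TE a : cl_even a -> delta2 a *m T = T *m delta1 a.
  exact: average_intertwines_rep.
have [a v ea Tv|//|inj] := irreducible_ker (T := T) irr1.
  by rewrite mulmxA -TE // -mulmxA Tv mulmx0.
by case: neq; exists T => [|a /TE //]; exact: unitmx_injective.
Qed.

End Irreducible.

Lemma mxtrace_direct_sum (R : realType) (r n d m : nat)
    (rho : clifford R r -> 'M[R]_n) (sigma : 'I_m -> clifford R r -> 'M[R]_d)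
    a : is_direct_sum rho sigma -> cl_even a ->
  \tr (rho a) = \sum_k \tr (sigma k a).
Proof.
move=> [P [PE [h fK hK]]] ea.
(* The inverse [h] is given only as a map of sets. Its values on the unit vectors define matrices
   [Q k]; they satisfy [PQ] because [h] is a right inverse, and [QP] because it is a left one. *)
pose Q k : 'M[R]_(d, n) := \matrix_(i, j) h (delta_mx j 0) k i 0.
have colE p q (B : 'M[R]_(p, q)) j : col j B = B *m delta_mx j 0.
  by rewrite colE.
have QE k j : Q k *m delta_mx j 0 = h (delta_mx j 0) k.
  by rewrite -colE; apply/matrixP => i l; rewrite !mxE !ord1.
have col_eq p q (B C : 'M[R]_(p, q)) :
    (forall j, B *m delta_mx j (0 : 'I_1) = C *m delta_mx j 0) -> B = C.
  move=> BC; apply/matrixP => i j; have := BC j; rewrite -!colE.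
  by move=> /matrixP/(_ i 0); rewrite !mxE.
have PQ : \sum_k P k *m Q k = 1%:M.
  apply: col_eq => j; rewrite mul1mx mulmx_suml -[RHS]hK; apply: eq_bigr => k _.
  by rewrite -mulmxA QE.
have QP k : Q k *m P k = 1%:M.
  apply: col_eq => j; rewrite mul1mx.
  pose w : {ffun 'I_m -> 'cV[R]_d} :=
    [ffun l => if l == k then delta_mx j 0 else 0].
  have fw : \sum_l P l *m w l = P k *m delta_mx j 0.
    rewrite (bigD1 k) //= big1 ?addr0 ?ffunE ?eqxx // => l lk.
    by rewrite ffunE (negPf lk) mulmx0.
  have : [ffun l => Q l *m (P k *m delta_mx j 0)] = w.
    apply: (can_inj fK) => /=; rewrite fw -[RHS]mul1mx -PQ mulmx_suml.
    by apply: eq_bigr => l _; rewrite ffunE !mulmxA.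
  by move=> /ffunP/(_ k); rewrite !ffunE eqxx !mulmxA.
rewrite -[rho a]mulmx1 -PQ mulmx_sumr raddf_sum /=; apply: eq_bigr => k _.
by rewrite mulmxA PE // -mulmxA mxtrace_mulC -mulmxA QP mulmx1.
Qed.

(** * Skew endomorphisms normalizing the spin algebra *)

Section SpinSpan.
Context {R : realType} {r n : nat} (rho : clifford R r -> 'M[R]_n).
Hypothesis rho_rep : even_rep rho.
Implicit Types (A B : {set 'I_r}) (X Y : 'M[R]_n).
Local Notation J := (rep_basis rho).

Definition spin_span X := exists c : {set 'I_r} -> R,
  X = \sum_(A : {set 'I_r} | #|A| == 2) c A *: J A.

Lemma even_card2 A : #|A| == 2 -> even_set A.
Proof. by rewrite /even_set => /eqP->. Qed.

Lemma spin_span0 : spin_span 0.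
Proof. by exists (fun=> 0); rewrite big1 // => A _; rewrite scale0r. Qed.

Lemma spin_spanD X Y : spin_span X -> spin_span Y -> spin_span (X + Y).
Proof.
move=> [c ->] [d ->]; exists (fun A => c A + d A); rewrite -big_split.
by apply: eq_bigr => A _; rewrite scalerDl.
Qed.

Lemma spin_spanZ k X : spin_span X -> spin_span (k *: X).
Proof.
move=> [c ->]; exists (fun A => k * c A); rewrite scaler_sumr.
by apply: eq_bigr => A _; rewrite scalerA.
Qed.

Lemma spin_span_sum (I : finType) (P : pred I) (G : I -> 'M[R]_n) :
  (forall i, P i -> spin_span (G i)) -> spin_span (\sum_(i | P i) G i).
Proof.
move=> PG; elim/big_ind: _ => //; first exact: spin_span0.
exact: spin_spanD.
Qed.

Lemma spin_span_basis A : #|A| == 2 -> spin_span (J A).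
Proof.
move=> A2; exists (fun B => (B == A)%:R); rewrite (bigD1 A) //= eqxx scale1r.
by rewrite big1 ?addr0 // => B /andP[_ /negPf->]; rewrite scale0r.
Qed.

Lemma spin_span_conj B X : even_set B -> spin_span X ->
  spin_span (conj_basis rho rho B X).
Proof.
move=> eB [c ->]; rewrite conj_basis_sum; apply: spin_span_sum => A A2.
rewrite /conj_basis -scalemxAr rep_basis_swap //; last exact: even_card2.
rewrite -!scalemxAl -mulmxA rep_basis_sqr // mul_mx_scalar.
by do 4! apply: spin_spanZ; exact: spin_span_basis.
Qed.

(** Two pairs that are disjoint or equal give commuting elements. If they share one index, the
    elements anticommute and their product is, up to sign, the element of the two remaining
    indices. *)
Lemma spin_span_bracket B X : #|B| == 2 -> spin_span X ->
  spin_span (X *m J B - J B *m X).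
Proof.
move=> B2 [c ->]; rewrite mulmx_suml mulmx_sumr -sumrB.
apply: spin_span_sum => A A2; rewrite -scalemxAl -scalemxAr -scalerBr.
apply: spin_spanZ; have [eA eB] := (even_card2 A2, even_card2 B2).
rewrite (rep_basis_swap rho_rep eB eA) -signr_odd finset.setIC.
case: (boolP (odd _)) => oAB; last by rewrite expr0 scale1r subrr; exact: spin_span0.
rewrite expr1 scaleN1r opprK rep_basisM // -scalerDl.
apply: spin_spanZ; apply: spin_span_basis.
have := card_symdiff A B; have := subset_leq_card (finset.subsetIl A B).
rewrite (eqP A2) (eqP B2); move: oAB.
case: #|(A :&: B)%SET| => [//|[_ _ E|[//|//]]]; apply/eqP; move: E; lia.
Qed.

Lemma rep_gen_mul (i j : 'I_r) : (i < j)%N ->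
  rho (cl_gen i * cl_gen j) = J (symdiff [set i]%SET [set j]%SET).
Proof.
move=> ij; congr (rho _).
transitivity (clsign [set i]%SET [set j]%SET *:
   cl_basis (symdiff [set i]%SET [set j]%SET) : clifford R r).
  exact: cl_mul_basis.
by rewrite clsign11 leqNgt ij expr0 scale1r.
Qed.

Lemma card_pair (i j : 'I_r) : (i < j)%N ->
  #|symdiff [set i]%SET [set j]%SET| == 2.
Proof.
move=> ij; have nij : i != j by apply: contraTneq ij => ->; rewrite ltnn.
by rewrite symdiff1 // cards2 nij.
Qed.

Definition spin_mx : 'M[R]_(n * n) :=
  (\sum_(A : {set 'I_r} | #|A| == 2) <<mxvec (J A)>>)%MS.

Lemma spin_span_sub X : spin_span X -> (mxvec X <= spin_mx)%MS.
Proof.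
move=> [c ->]; rewrite linear_sum; apply: summx_sub => A A2 /=.
rewrite linearZ scalemx_sub // (sumsmx_sup A) // genmxE.
exact: submx_refl.
Qed.

Lemma rank_spin_mx : (\rank spin_mx <= 'C(r, 2))%N.
Proof.
apply: leq_trans (mxrank_sum_leqif _).1 _ => /=.
rewrite -[X in 'C(X, _)]card_ord -card_draws -sum1_card big_mkcond.
rewrite [leqRHS]big_mkcond; apply: leq_sum => A _; rewrite inE.
by case: ifP => // _; rewrite mxrank_gen rank_leq_row.
Qed.

End SpinSpan.

Section SkewNormalizer.
Context {R : realType} {r n : nat} (g : 'M[R]_n) (rho : clifford R r -> 'M[R]_n).
Hypotheses (g_unit : g \in unitmx) (g_sym : g^T = g).
Hypothesis rho_cliff : linear_even_clifford g rho.
Implicit Types (A B : {set 'I_r}) (X Y : 'M[R]_n).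
Local Notation J := (rep_basis rho).
Let rho_rep := rho_cliff.1.

Definition adjoint X := invmx g *m X^T *m g.

Lemma adjointK X : adjoint (adjoint X) = X.
Proof.
rewrite /adjoint !trmx_mul trmx_inv trmxK g_sym !mulmxA mulVmx // mul1mx.
by rewrite mulmxKV.
Qed.

Lemma adjointM X Y : adjoint (X *m Y) = adjoint Y *m adjoint X.
Proof. by rewrite /adjoint trmx_mul !mulmxA mulmxK. Qed.

Lemma adjoint_is_linear : linear adjoint.
Proof.
move=> k X Y; rewrite /adjoint linearD linearZ /= mulmxDr mulmxDl.
by rewrite -scalemxAr -scalemxAl.
Qed.

HB.instance Definition _ := GRing.isLinear.Build R 'M[R]_n 'M[R]_n _ adjoint
  adjoint_is_linear.

(** Each J_ij is skew with square -1, hence orthogonal for g, and so is every even product. The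
    adjoint of J_A is then its inverse. *)
Lemma adjoint_basis A : even_set A -> adjoint (J A) = clsign A A *: J A.
Proof.
have orth : even_set A -> (J A)^T *m g *m J A = g.
  move: A; apply: even_set_ind => [|i j A ij eA IH].
    by rewrite rep_basis0 // trmx1 mul1mx mulmx1.
  have [skew sqr] := rho_cliff.2 i j ij.
  set B := symdiff [set i]%SET _; have eB : even_set B by exact: even_pair.
  have -> : J (symdiff B A) = clsign B A *: (J B *m J A).
    by rewrite rep_basisM // scalerA clsign_sqr scale1r.
  rewrite [(_ *: _)^T]linearZ /= -!scalemxAl -scalemxAr scalerA clsign_sqr scale1r.
  rewrite trmx_mul -!mulmxA (mulmxA g) (mulmxA _ (g *m _)) (mulmxA _ g).
  rewrite -rep_gen_mul // skew mulNmx -mulmxA sqr mulmxN opprK mulmx1.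
  by rewrite mulmxA.
move=> eA; have /(congr1 (mulmx^~ (J A))) := orth eA.
rewrite -mulmxA rep_basis_sqr // mul_mx_scalar /adjoint => E.
rewrite -mulmxA -[J A in RHS](mulKmx g_unit) -E -scalemxAr scalerA.
by rewrite clsign_sqr scale1r.
Qed.

Lemma adjoint_conj A X : even_set A ->
  adjoint (conj_basis rho rho A X) = conj_basis rho rho A (adjoint X).
Proof.
move=> eA; rewrite /conj_basis linearZ /= !adjointM adjoint_basis //.
rewrite -!scalemxAl -!scalemxAr [in LHS]scalerA clsign_sqr scale1r.
by rewrite mulmxA.
Qed.

Lemma adjoint_average X :
  adjoint (average rho rho X) = average rho rho (adjoint X).
Proof.
rewrite /average linear_sum; apply: eq_bigr => A eA; exact: adjoint_conj.
Qed.

Definition card_even : R := \sum_(A : {set 'I_r} | even_set A) 1.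

Lemma card_even_neq0 : card_even != 0.
Proof.
rewrite /card_even sumr_const pnatr_eq0 -lt0n; apply/card_gt0P.
by exists finset.set0; exact: even_set0.
Qed.

(** Division by [card_even] turns the average into a projection onto the commutant, and the factor
    1/2 belongs to the skew part (Y - adjoint Y) / 2. The two projections commute by
    [adjoint_average]. *)
Definition skew_commutant_proj X := (2 * card_even)^-1 *:
  (average rho rho X - adjoint (average rho rho X)).

Lemma skew_commutant_proj_is_linear : linear skew_commutant_proj.
Proof.
move=> k X Y; rewrite /skew_commutant_proj !adjoint_average.
have avgD U V : average rho rho (k *: U + V) =
    k *: average rho rho U + average rho rho V.
  rewrite /average scaler_sumr -big_split; apply: eq_bigr => A _.
  rewrite /conj_basis mulmxDr mulmxDl -scalemxAr -scalemxAl /=.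
  by rewrite [in LHS]scalerDr !scalerA mulrC.
rewrite avgD [adjoint (_ + _)]adjoint_is_linear avgD scalerA -[k * _]mulrC -scalerA -scalerDr.
by congr (_ *: _); rewrite scalerBr opprD addrACA.
Qed.

HB.instance Definition _ := GRing.isLinear.Build R 'M[R]_n 'M[R]_n _
  skew_commutant_proj skew_commutant_proj_is_linear.

Lemma average_fixed X :
  (forall A, even_set A -> J A *m X = X *m J A) ->
  average rho rho X = card_even *: X.
Proof.
move=> cX; rewrite /card_even scaler_suml; apply: eq_bigr => A eA.
by rewrite scale1r; apply/conj_basis_fixed => //; exact: cX.
Qed.

Lemma skew_commutant_proj_id X : adjoint X = - X ->
  (forall A, even_set A -> J A *m X = X *m J A) ->
  skew_commutant_proj X = X.
Proof.
move=> sX cX; rewrite /skew_commutant_proj average_fixed // [adjoint _]linearZ /= sX.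
rewrite scalerN opprK -scalerDl scalerA.
rewrite (_ : _ * _ = 1) ?scale1r //; field; exact: card_even_neq0.
Qed.

Lemma skew_commutant_proj_idem X :
  skew_commutant_proj (skew_commutant_proj X) = skew_commutant_proj X.
Proof.
apply: skew_commutant_proj_id => [|A eA].
  by rewrite linearZ linearB /= adjointK -scalerN opprB.
rewrite /skew_commutant_proj adjoint_average -scalemxAr -scalemxAl.
by rewrite mulmxBr mulmxBl !average_intertwines.
Qed.

(** The rank of an idempotent is its trace. The averaging part contributes the squares of the
    characters. In the part with the adjoint, the term of A has trace the sign of e_A^2 times that
    of J_A (adjoint J_A) = 1, hence the n. *)
Lemma rank_skew_commutant_proj : (\rank (lin_mx skew_commutant_proj))%:R =
  (2 * card_even)^-1 * \sum_(A : {set 'I_r} | even_set A)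
    clsign A A * (\tr (J A) ^+ 2 - n%:R) :> R.
Proof.
rewrite -mxtrace_idempotent; last first.
  apply/row_matrixP => i; rewrite !rowE mulmxA.
  rewrite -[delta_mx 0 i]vec_mxK !mul_vec_lin.
  by rewrite /= skew_commutant_proj_idem.
rewrite mxtrace_lin_mx.
have -> : \sum_(A : {set 'I_r} | even_set A) clsign A A * (\tr (J A) ^+ 2 - n%:R)
   = \sum_i \sum_j average rho rho (delta_mx i j) i j
     - \sum_i \sum_j adjoint (average rho rho (delta_mx i j)) i j.
  rewrite sum_delta_average //.
  under [X in _ = _ - X]eq_bigr => i _.
    under eq_bigr => j _ do rewrite adjoint_average /average summxE.
    rewrite exchange_big; over.
  rewrite [X in _ = _ - X]exchange_big /= -sumrB; apply: eq_bigr => A eA.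
  rewrite mulrBr expr2; congr (_ - _).
  under eq_bigr => i _ do under eq_bigr => j _ do
    rewrite /conj_basis /adjoint mxE !mulmxA -[X in _ * X]/(_) -mulmxA.
  under eq_bigr => i _ do rewrite -mulr_sumr.
  rewrite -mulr_sumr sum_delta_mul_tr trmx_mul g_sym.
  congr (_ * _).
  rewrite -(mulmxA (J A)) (mulmxA (invmx g)) -/(adjoint (J A)) adjoint_basis //.
  rewrite -scalemxAr rep_basis_sqr // scale_scalar_mx clsign_sqr.
  by rewrite mxtrace1.
rewrite -sumrB mulr_sumr; apply: eq_bigr => i _.
rewrite -sumrB mulr_sumr; apply: eq_bigr => j _.
by rewrite !mxE.
Qed.

(* Conjugation by J = J_ij moves X by [X, J] J, which lies in the spin span since
   [X, J] anticommutes with J, so that [X, J] J is half a bracket of two elements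
   of the span. Hence X is its own average modulo the span. *)
Lemma skew_normalizer X : X^T *m g = - (g *m X) ->
  (forall i j : 'I_r, (i < j)%N ->
     let Jij := rho (cl_gen i * cl_gen j) in
     spin_span rho (X *m Jij - Jij *m X)) ->
  (mxvec X <= spin_mx rho + lin_mx skew_commutant_proj)%MS.
Proof.
move=> sX brX.
have conjX A : even_set A -> spin_span rho (conj_basis rho rho A X - X).
  move: A; apply: even_set_ind => [|i j A ij eA IH].
    rewrite /conj_basis rep_basis0 // mul1mx mulmx1 clsigns0 scale1r subrr.
    exact: spin_span0.
  set B := symdiff [set i]%SET _; have eB : even_set B by exact: even_pair.
  have B2 : #|B| == 2 by exact: card_pair.
  have conjB : spin_span rho (conj_basis rho rho B X - X).
    have := brX i j ij; rewrite /= rep_gen_mul // -/B => YQ.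
    have sqr : J B *m J B = - 1%:M.
      by rewrite -rep_gen_mul //; case: (rho_cliff.2 i j ij).
    have sB : clsign B B = -1 :> R.
      by rewrite clsign_self (eqP B2) (_ : 'C(3, 2) = 3) // -signr_odd expr1.
    have := spin_spanZ (2^-1) (spin_span_bracket rho_rep B2 YQ).
    congr (spin_span _ _); rewrite /conj_basis sB scaleN1r.
    rewrite mulmxBl mulmxBr -!mulmxA sqr !mulmxA sqr mulmxN mulmx1 mulNmx mul1mx.
    apply/matrixP => k l; rewrite !mxE; lra.
  have conjD Y Z : conj_basis rho rho B (Y + Z) =
      conj_basis rho rho B Y + conj_basis rho rho B Z.
    by rewrite /conj_basis mulmxDr mulmxDl scalerDr.
  rewrite -conj_basisM // -[conj_basis rho rho A X](subrK X) conjD.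
  rewrite -addrA; apply: spin_spanD => //; exact: spin_span_conj.
have aX : adjoint X = - X.
  by rewrite /adjoint -mulmxA sX mulmxN mulKmx.
(* The average of a skew X is already skew, so taking the skew part changes nothing. *)
have E : skew_commutant_proj X = card_even^-1 *: average rho rho X.
  rewrite /skew_commutant_proj adjoint_average aX.
  have -> : average rho rho (- X) = - average rho rho X.
    rewrite /average -sumrN; apply: eq_bigr => A _.
    by rewrite /conj_basis mulmxN mulNmx scalerN.
  rewrite opprK -[average rho rho X]scale1r -scalerDl !scalerA.
  by congr (_ *: _); field; exact: card_even_neq0.
(* The first summand is minus the mean of the differences in [conjX], which lie in the spin span. *)
have -> : X = - card_even^-1 *: (average rho rho X - card_even *: X)
    + skew_commutant_proj X.
  rewrite E scalerBr scalerA mulNr mulVf ?card_even_neq0 // scaleN1r opprK.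
  by rewrite scaleNr addrAC addNr add0r.
rewrite linearD /= addmx_sub_adds //.
  apply: spin_span_sub; apply: spin_spanZ.
  rewrite /card_even scaler_suml -sumrB; apply: spin_span_sum => A eA.
  by rewrite scale1r; exact: conjX.
by rewrite -skew_commutant_proj_idem -mul_vec_lin submxMl.
Qed.

End SkewNormalizer.

(** * Dimension of the skew commutant *)

Section Dimensions.
Context {R : realType} {r : nat}.
Implicit Types (A B : {set 'I_r}).

Lemma sum_even_support (f : {set 'I_r} -> R) : (0 < r)%N ->
  (forall A, even_set A -> A != finset.set0 -> A != finset.setT -> f A = 0) ->
  \sum_(A | even_set A) f A =
  f finset.set0 + (if odd r then 0 else f finset.setT).
Proof.
move=> r_gt0 f0; rewrite (bigD1 finset.set0) ?even_set0 //=; congr (_ + _).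
have eT : even_set [set: 'I_r]%SET = ~~ odd r.
  by rewrite /even_set cardsT card_ord.
have T0 : [set: 'I_r]%SET != finset.set0.
  by rewrite -card_gt0 cardsT card_ord.
case: ifPn => [or|er].
  rewrite big1 // => A /andP[eA A0]; apply: f0 => //.
  by apply: contraTneq eA => ->; rewrite eT or.
rewrite (bigD1 finset.setT) /= ?eT ?er // big1 ?addr0 // => A.
by move=> /andP[/andP[eA A0] AT]; exact: f0.
Qed.

Lemma clsignT : clsign [set: 'I_r]%SET [set: 'I_r]%SET = (-1) ^+ 'C(r.+1, 2) :> R.
Proof. by rewrite clsign_self cardsT card_ord. Qed.

Lemma bin2R m : 'C(m, 2)%:R = m%:R * (m%:R - 1) / 2 :> R.
Proof.
case: m => [|m]; first by rewrite bin0n /= !mul0r.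
have : (2 * 'C(m.+1, 2) = m.+1 * m)%N.
  by rewrite bin2 -[RHS]odd_double_half mul2n oddM /= andNb add0n.
move=> /(congr1 (fun k => k%:R : R)); rewrite !natrM -[m.+1]addn1 natrD => E.
by apply: (mulfI (_ : 2 != 0)) => //; rewrite E; field.
Qed.

Lemma card_evenE : (0 < r)%N -> 2 * @card_even R r = 2 ^+ r.
Proof.
by rewrite /card_even; case: r => // r' _; rewrite card_even_sets exprS.
Qed.

Section Fixed.
Context {n : nat} (g : 'M[R]_n) (rho : clifford R r -> 'M[R]_n).
Hypotheses (g_unit : g \in unitmx) (g_sym : g^T = g).
Hypothesis rho_cliff : linear_even_clifford g rho.
Hypothesis r_ge3 : (3 <= r)%N.
Local Notation chiT := (\tr (rep_basis rho finset.setT)).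
Local Notation rk := (\rank (lin_mx (skew_commutant_proj g rho))).

Lemma rank_skew_commutantE : 2 ^+ r * rk%:R = n%:R ^+ 2 +
  (if odd r then 0 else (-1) ^+ 'C(r.+1, 2) * chiT ^+ 2)
  - even_sign_sum r * n%:R :> R.
Proof.
have r0 : (0 < r)%N by lia.
rewrite (rank_skew_commutant_proj g_unit g_sym rho_cliff) -card_evenE //.
rewrite mulVKf ?mulf_neq0 ?card_even_neq0 ?pnatr_eq0 //.
under eq_bigr => A _ do rewrite mulrBr.
rewrite sumrB -mulr_suml sum_clsign; congr (_ - _).
rewrite sum_even_support // => [|A eA A0 AT]; last first.
  by rewrite (mxtrace_rep_basis rho_cliff.1) // expr0n mulr0.
by rewrite clsign0s mul1r (rep_basis0 rho_cliff.1) mxtrace1 clsignT.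
Qed.

End Fixed.
End Dimensions.

(** * Arithmetic of the dimension formulas modulo 8 *)

Section DimensionBounds.
Context {R : realType}.
Implicit Types (r n m k q s : nat) (t : R).

Lemma sign_bin2 q s : (-1) ^+ 'C((8 * q + s).+1, 2) = (-1) ^+ 'C(s.+1, 2) :> R.
Proof.
rewrite -signr_odd -[RHS]signr_odd; congr (_ ^+ _); congr (nat_of_bool _).
have E : 'C((8 * q + s).+1, 2) = (2 * (q * (8 * q + 1 + 2 * s) * 2) + 'C(s.+1, 2))%N.
  have b2 k : (2 * 'C(k.+1, 2) = k.+1 * k)%N.
    by rewrite bin2 -[RHS]odd_double_half mul2n oddM /= andNb add0n.
  by have := b2 s; have := b2 (8 * q + s)%N; nia.
by rewrite E oddD oddM.
Qed.

Lemma even_sign_sum8 q s : even_sign_sum (8 * q + s) =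
  16 ^+ q * even_sign_sum s :> R.
Proof.
rewrite (_ : 8 * q = 4 * (2 * q))%N; last by lia.
by rewrite even_sign_sumE exprM; congr (_ ^+ _ * _); ring.
Qed.

Lemma even_sign_sum_values : [/\ even_sign_sum 4 = -4 :> R,
  even_sign_sum 5 = -4 :> R, even_sign_sum 6 = 0 :> R &
  even_sign_sum 7 = 8 :> R].
Proof.
have [s0 s1 s2 s3] := @even_sign_sum_small R.
rewrite -[4%N]/(0 + 4)%N -[5%N]/(1 + 4)%N -[6%N]/(2 + 4)%N -[7%N]/(3 + 4)%N.
by rewrite !even_sign_sum4 s0 s1 s2 s3; split; ring.
Qed.

(** Doubling removes the -1 from the exponent r/2 - 1 of the case r = 0 mod 8, so that one table
    covers all residues. Positivity of r excludes r = 0, where the truncated exponent would give 1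
    instead of 1/2. *)
Lemma spinor_dim8 q s : (s < 8)%N -> (0 < 8 * q + s)%N ->
  (spinor_dim (8 * q + s))%:R * 2 = 16 ^+ q *
  nth 0 [:: 1; 2; 4; 8; 8; 16; 16; 16] s :> R.
Proof.
move=> s8; rewrite /spinor_dim (mulnC 8) modnMDl modn_small //.
case: s s8 => [|[|[|[|[|[|[|[|s]]]]]]]] // _ r0 /=.
- rewrite (_ : (q * 8 + 0) %/ 2 - 1 = 4 * q - 1)%N; last lia.
  rewrite natrX -exprSr (_ : (4 * q - 1).+1 = 4 * q)%N; last lia.
  by rewrite exprM mulr1; congr (_ ^+ _); ring.
all: rewrite natrX -exprSr.
- rewrite (_ : ((q * 8 + 1 - 1) %/ 2).+1 = 4 * q + 1)%N; last lia.
  by rewrite exprD exprM; congr (_ ^+ _ * _); ring.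
- rewrite (_ : ((q * 8 + 2) %/ 2).+1 = 4 * q + 2)%N; last lia.
  by rewrite exprD exprM; congr (_ ^+ _ * _); ring.
- rewrite (_ : ((q * 8 + 3 + 1) %/ 2).+1 = 4 * q + 3)%N; last lia.
  by rewrite exprD exprM; congr (_ ^+ _ * _); ring.
- rewrite (_ : ((q * 8 + 4) %/ 2).+1 = 4 * q + 3)%N; last lia.
  by rewrite exprD exprM; congr (_ ^+ _ * _); ring.
- rewrite (_ : ((q * 8 + 5 + 1) %/ 2).+1 = 4 * q + 4)%N; last lia.
  by rewrite exprD exprM; congr (_ ^+ _ * _); ring.
- rewrite (_ : ((q * 8 + 6) %/ 2).+1 = 4 * q + 4)%N; last lia.
  by rewrite exprD exprM; congr (_ ^+ _ * _); ring.
- rewrite (_ : ((q * 8 + 7 - 1) %/ 2).+1 = 4 * q + 4)%N; last lia.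
  by rewrite exprD exprM; congr (_ ^+ _ * _); ring.
Qed.

Lemma le_of_eq (x y : R) : x = y -> x <= y.
Proof. by move->. Qed.

(** With x = 16^q, both 2^r and n^2 are multiples of x^2, d_r is a constant times x, and the
    equation can be divided by x^2. It then yields an equality for odd r. For r = 2, 6 mod 8 the
    term -t^2 is discarded, which leaves an inequality. *)
Lemma rank_bound r n m k t : (3 <= r)%N -> ~~ (4 %| r)%N ->
  n = (spinor_dim r * m)%N ->
  2 ^+ r * k%:R = n%:R ^+ 2 +
    (if odd r then 0 else (-1) ^+ 'C(r.+1, 2) * t ^+ 2)
    - even_sign_sum r * n%:R ->
  (k + 'C(r, 2) + n <= dmax r m)%N.
Proof.
move=> r3 r4 nE kE; rewrite /dmax -nE !leq_add2r -(ler_nat R).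
move: nE r4 kE r3; rewrite (divn_eq r 8) (mulnC (r %/ 8)%N).
have := ltn_pmod r (isT : (0 < 8)%N); move: (r %/ 8)%N (r %% 8)%N => q s s8.
move=> nE r4 kE r3.
have r0 : (0 < 8 * q + s)%N by lia.
have := spinor_dim8 s8 r0.
set d := (spinor_dim _)%:R => dE.
have {}nE : n%:R = d * m%:R by rewrite nE natrM. clearbody d.
have x0 : 0 < 16 ^+ q :> R by rewrite exprn_gt0.
have e8 : 2 ^+ (8 * q + s) = (16 ^+ q) ^+ 2 * 2 ^+ s :> R.
  have -> : 16 = 2 ^+ 4 :> R by ring.
  by rewrite exprD -!exprM; congr (_ ^+ _ * _); lia.
move: kE; rewrite e8 sign_bin2 even_sign_sum8 oddD oddM /= nE.
rewrite (mulnC 8) modnMDl modn_small //.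
have [s0 s1 s2 s3] := @even_sign_sum_small R.
have [s4 s5 s6 s7] := even_sign_sum_values.
have t2 : 0 <= t ^+ 2 by exact: sqr_ge0.
move: dE x0; move: (16 ^+ q) => x dE x0 {nE e8 r3 r0}.
have leK c v : x ^+ 2 * 2 ^+ c * k%:R <= x ^+ 2 * 2 ^+ c * v -> k%:R <= v.
  by rewrite ler_pM2l // mulr_gt0 ?exprn_gt0.
case: s s8 r4 dE => [|[|[|[|[|[|[|[|s]]]]]]]] // _ r4 /= dE kE.
- by case/negP: r4; rewrite addn0 (dvdn_mulr q (isT : 4 %| 8)%N).
- have {}dE : d = x by lra.
  by apply: (leK 1); rewrite kE s1 dE bin2R; apply: le_of_eq; field.
- have {}dE : d = 2 * x by lra.
  apply: (leK 2); rewrite kE s2 dE natrX (_ : 'C(3, 2) = 3) // -signr_odd expr1; nra.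
- have {}dE : d = 4 * x by lra.
  by apply: (leK 3); rewrite kE s3 dE bin2R natrD natrM; apply: le_of_eq; field.
- by case/negP: r4; rewrite dvdn_addl ?(dvdn_mulr q (isT : 4 %| 8)%N).
- have {}dE : d = 8 * x by lra.
  by apply: (leK 5); rewrite kE s5 dE bin2R natrD natrM; apply: le_of_eq; field.
- have {}dE : d = 8 * x by lra.
  apply: (leK 6); rewrite kE s6 dE natrX (_ : 'C(7, 2) = 21) // -signr_odd expr1; nra.
- have {}dE : d = 8 * x by lra.
  by apply: (leK 7); rewrite kE s7 dE bin2R; apply: le_of_eq; field.
Qed.

(** Here the volume element squares to 1, and (m1 + m2)^2 + (m1 - m2)^2 = 2 m1^2 + 2 m2^2 separates
    the two multiplicities. *)
Lemma rank_bound2 r n m1 m2 k t : (3 <= r)%N -> (4 %| r)%N ->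
  n = (spinor_dim r * (m1 + m2))%N ->
  t ^+ 2 = ((spinor_dim r)%:R * (m1%:R - m2%:R)) ^+ 2 ->
  2 ^+ r * k%:R = n%:R ^+ 2 +
    (if odd r then 0 else (-1) ^+ 'C(r.+1, 2) * t ^+ 2)
    - even_sign_sum r * n%:R ->
  (k + 'C(r, 2) + n <= dmax2 r m1 m2)%N.
Proof.
move=> r3 r4 nE tE kE; rewrite /dmax2 -nE !leq_add2r -(ler_nat R).
move: nE r4 tE kE r3; rewrite (divn_eq r 8) (mulnC (r %/ 8)%N).
have := ltn_pmod r (isT : (0 < 8)%N); move: (r %/ 8)%N (r %% 8)%N => q s s8.
move=> nE r4 tE kE r3.
have r0 : (0 < 8 * q + s)%N by lia.
move: tE; have := spinor_dim8 s8 r0.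
set d := (spinor_dim _)%:R => dE tE.
have {}nE : n%:R = d * (m1%:R + m2%:R) by rewrite nE natrM natrD.
clearbody d.
have x0 : 0 < 16 ^+ q :> R by rewrite exprn_gt0.
have e8 : 2 ^+ (8 * q + s) = (16 ^+ q) ^+ 2 * 2 ^+ s :> R.
  have -> : 16 = 2 ^+ 4 :> R by ring.
  by rewrite exprD -!exprM; congr (_ ^+ _ * _); lia.
move: kE; rewrite e8 sign_bin2 even_sign_sum8 oddD oddM /= nE tE.
rewrite (mulnC 8) modnMDl modn_small //.
have [s0 _ _ _] := @even_sign_sum_small R.
have [s4 _ _ _] := even_sign_sum_values.
move: dE x0; move: (16 ^+ q) => x dE x0 {tE nE e8 r3 r0}.
have leK c v : x ^+ 2 * 2 ^+ c * k%:R <= x ^+ 2 * 2 ^+ c * v -> k%:R <= v.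
  by rewrite ler_pM2l // mulr_gt0 ?exprn_gt0.
have s4' : (4 %| s)%N by rewrite dvdn_addr ?(dvdn_mulr q (isT : 4 %| 8)%N) in r4.
case: s s8 r4 s4' dE => [|[|[|[|[|s]]]]] //; first last.
- by case: s => [|[|[|s]]].
- move=> _ _ _ /= dE kE; have {}dE : d = 4 * x by lra.
  apply: (leK 4); rewrite kE s4 dE !natrD !bin2R !natrD.
  by rewrite (_ : 'C(5, 2) = 10) // -signr_odd expr0; apply: le_of_eq; field.
- move=> _ _ _ /= dE kE; have {}dE : d = x / 2 by lra.
  apply: (leK 0); rewrite kE s0 dE !natrD !bin2R.
  by rewrite (_ : 'C(1, 2) = 0) // expr0; apply: le_of_eq; field.
Qed.

End DimensionBounds.

Section SpinNormalizer.
Context {R : realType} {r n : nat} (g : 'M[R]_n) (rho : clifford R r -> 'M[R]_n).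
Hypotheses (g_unit : g \in unitmx) (g_sym : g^T = g) (r_ge3 : (3 <= r)%N).
Hypothesis rho_cliff : linear_even_clifford g rho.

Definition skew_spin_normalizer (X : 'M[R]_n) :=
  X^T *m g = - (g *m X) /\
  forall i j : 'I_r, (i < j)%N ->
    let J := rho (cl_gen i * cl_gen j) in spin_span rho (X *m J - J *m X).

(** [W] contains the possible derivatives, at a point, of a field vanishing there. The summand n
    accounts for the values at the point, so b bounds the dimension of the space of 1-jets. *)
Definition normalizer_bound (b : nat) := exists2 W : 'M[R]_(n * n),
  (\rank W + n <= b)%N &
  forall X, skew_spin_normalizer X -> (mxvec X <= W)%MS.

Lemma normalizer_boundP b :
  (\rank (lin_mx (skew_commutant_proj g rho)) + 'C(r, 2) + n <= b)%N ->
  normalizer_bound b.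
Proof.
move=> kb; exists (spin_mx rho + lin_mx (skew_commutant_proj g rho))%MS.
  apply: leq_trans kb; rewrite leq_add2r addnC.
  apply: leq_trans (mxrank_adds_leqif _ _).1 _; rewrite leq_add2r.
  exact: rank_spin_mx.
by move=> X [sX nX]; exact: skew_normalizer.
Qed.

(** The two dimensions are compared through the traces of the unit. *)
Lemma direct_sum_dim d m (sigma : 'I_m -> clifford R r -> 'M[R]_d) :
  (forall k, even_rep (sigma k)) -> is_direct_sum rho sigma -> n = (d * m)%N.
Proof.
move=> rep_sigma sumE.
have e1 : cl_even (1 : clifford R r) by exact: (cl_even_basis even_set0).
have := mxtrace_direct_sum sumE e1; rewrite (even_rep1 rho_cliff.1) mxtrace1.
under eq_bigr => k _ do rewrite (even_rep1 (rep_sigma k)) mxtrace1.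
rewrite sumr_const card_ord -[_ *+ m]mulr_natr -natrM => /eqP; rewrite eqr_nat => /eqP.
by [].
Qed.

Lemma normalizer_bound_isotypic m (delta : clifford R r -> 'M[R]_(spinor_dim r)) :
  ~~ (4 %| r)%N -> even_rep delta -> is_direct_sum rho (fun _ : 'I_m => delta) ->
  normalizer_bound (dmax r m).
Proof.
move=> r4 rep_delta /direct_sum_dim nE; apply: normalizer_boundP.
apply: (rank_bound (t := \tr (rep_basis rho finset.setT)) r_ge3 r4).
  exact: nE.
exact: rank_skew_commutantE.
Qed.

Lemma normalizer_bound_two_types m1 m2
    (delta1 delta2 : clifford R r -> 'M[R]_(spinor_dim r)) :
  (4 %| r)%N -> even_rep delta1 -> irreducible_rep delta1 ->
  even_rep delta2 -> irreducible_rep delta2 -> ~ equivalent_rep delta1 delta2 ->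
  is_direct_sum rho
    (fun k : 'I_(m1 + m2) => if (k < m1)%N then delta1 else delta2) ->
  normalizer_bound (dmax2 r m1 m2).
Proof.
move=> r4 rep1 irr1 rep2 irr2 neq sumE.
have nE : n = (spinor_dim r * (m1 + m2))%N.
  by apply: direct_sum_dim sumE => k; case: ifP.
apply: normalizer_boundP.
apply: (rank_bound2 (t := \tr (rep_basis rho finset.setT)) r_ge3 r4 nE);
  last exact: rank_skew_commutantE.
have even_r : odd r = false.
  by apply/negbTE; rewrite -dvdn2; exact: dvdn_trans r4.
have eT : even_set [set: 'I_r]%SET by rewrite /even_set cardsT card_ord even_r.
have sT : clsign [set: 'I_r]%SET [set: 'I_r]%SET = 1 :> R.
  rewrite clsignT -signr_odd; move/dvdnP: r4 => [q ->].
  rewrite (_ : 'C((q * 4).+1, 2) = (2 * (q * (q * 4).+1))%N) ?oddM //.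
  have : (2 * 'C((q * 4).+1, 2) = (q * 4).+1 * (q * 4))%N.
    by rewrite bin2 -[RHS]odd_double_half mul2n oddM /= andNb add0n.
  lia.
have pm (delta : clifford R r -> 'M[R]_(spinor_dim r)) : even_rep delta ->
    irreducible_rep delta -> exists2 e : R, e ^+ 2 = 1 &
      \tr (rep_basis delta finset.setT) = e * (spinor_dim r)%:R.
  move=> rep irr; have [B eB|->|->] := central_basis_irreducible rep irr eT sT.
  - rewrite (rep_basis_swap rep eT eB) finset.setTI -signr_odd.
    by move: eB; rewrite /even_set => /negPf->; rewrite expr0 scale1r.
  - by exists 1; rewrite ?expr1n // mul1r mxtrace1.
  - by exists (-1); rewrite ?sqrrN ?expr1n // raddfN /= mxtrace1 mulN1r.
have [e1 e1E t1] := pm _ rep1 irr1; have [e2 e2E t2] := pm _ rep2 irr2.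
have d0 : (spinor_dim r)%:R != 0 :> R.
  by rewrite pnatr_eq0 -lt0n; case: irr1.
(* In the orthogonality relation only the unit and the volume element have nonzero characters; what
   remains is d_r^2 (1 + e1 e2) = 0. *)
have e12 : e1 * e2 = -1.
  have := inequivalent_trace rep1 rep2 irr1 irr2 neq.
  rewrite sum_even_support; [|lia|]; last first.
    by move=> A eA A0 AT; rewrite (mxtrace_rep_basis rep1) // !mulr0.
  rewrite even_r clsign0s sT (rep_basis0 rep1) (rep_basis0 rep2) mxtrace1 t1 t2.
  move=> E; apply/eqP; rewrite -subr_eq0 opprK.
  have : (spinor_dim r)%:R ^+ 2 * (e1 * e2 + 1) = 0 by rewrite -[RHS]E; ring.
  by move/eqP; rewrite mulf_eq0 expf_eq0 (negPf d0) andbF.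
rewrite /rep_basis (mxtrace_direct_sum sumE); last exact: cl_even_basis.
have -> : \sum_(k < m1 + m2) \tr ((if (k < m1)%N then delta1 else delta2)
    (cl_basis finset.setT)) = (spinor_dim r)%:R * (e1 * m1%:R + e2 * m2%:R).
  rewrite big_split_ord /=.
  under eq_bigr => k _ do rewrite ltn_ord -/(rep_basis delta1 _) t1.
  under [X in _ + X]eq_bigr => k _ do
    rewrite ltnNge leq_addr /= -/(rep_basis delta2 _) t2.
  by rewrite !sumr_const !card_ord -(mulr_natr _ m1) -(mulr_natr _ m2); ring.
rewrite !exprMn; congr (_ * _).
transitivity (e1 ^+ 2 * m1%:R ^+ 2 + 2 * (e1 * e2) * m1%:R * m2%:R +
  e2 ^+ 2 * m2%:R ^+ 2); first by ring.
by rewrite e1E e2E e12; ring.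
Qed.

End SpinNormalizer.

Section SpinSpanMatrix.
Context {R : realType} {r n : nat} (rho : clifford R r -> 'M[R]_n).

(** As an inclusion of row spaces, membership in the span becomes the vanishing of a product with a
    cokernel matrix, an equation that can be differentiated. *)
Lemma spin_spanP X : (mxvec X <= spin_mx rho)%MS <-> spin_span rho X.
Proof.
split; last exact: spin_span_sub.
move=> /sub_sumsmxP[u uE]; suff [c cE] : exists c : {set 'I_r} -> R,
    forall A, u A *m <<mxvec (rep_basis rho A)>>%MS = c A *: mxvec (rep_basis rho A).
  exists c; rewrite -[X]mxvecK uE linear_sum /=.
  by apply: eq_bigr => A _; rewrite cE linearZ /= mxvecK.
pose P A k := u A *m <<mxvec (rep_basis rho A)>>%MS =
  k *: mxvec (rep_basis rho A).
have H A : {k | P A k}.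
  by apply/cid/sub_rVP; have := submxMl (u A) <<mxvec (rep_basis rho A)>>%MS;
    rewrite genmxE.
by exists (fun A => sval (H A)) => A; exact: svalP (H A).
Qed.

End SpinSpanMatrix.

(** * Symmetry of second derivatives and Gronwall's inequality *)

Section DirectionalDerivatives.
Context {R : realType}.

(** The two difference quotients coincide as functions of h. Lines, translations and time curves in
    a product are all instances. *)
Lemma is_derive_affine (U V W : normedModType R) (f : V -> W) (A : U -> V)
    x v w d : (forall h : R, A (h *: v + x) = h *: w + A x) ->
  is_derive (A x) w f d -> is_derive x v (f \o A) d.
Proof.
move=> AE [df <-].
have E : (fun h : R => h^-1 *: ((f \o A \o shift x) (h *: v) - (f \o A) x)) =
         (fun h : R => h^-1 *: ((f \o shift (A x)) (h *: w) - f (A x))).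
  by apply/funext => h /=; rewrite AE.
by split; rewrite ?/derivable ?/derive E.
Qed.

Lemma derive_affine (U V W : normedModType R) (f : V -> W) (A : U -> V)
    x v w : (forall h : R, A (h *: v + x) = h *: w + A x) ->
  'D_v (f \o A) x = 'D_w f (A x).
Proof.
move=> AE; rewrite /derive.
rewrite (_ : (fun h : R => h^-1 *: ((f \o A \o shift x) (h *: v) - (f \o A) x)) =
  (fun h : R => h^-1 *: ((f \o shift (A x)) (h *: w) - f (A x)))) //.
by apply/funext => h /=; rewrite AE.
Qed.

Lemma is_derive_line (V W : normedModType R) (f : V -> W) y w d (t : R) :
  is_derive (y + t *: w) w f d ->
  is_derive t 1 (fun s : R => f (y + s *: w)) d.
Proof.
move=> fd; have AE (h : R) : y + (h *: (1 : R^o) + t) *: w = h *: w + (y + t *: w).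
  by rewrite [h *: _]mulr1 scalerDl addrCA.
exact: (@is_derive_affine R^o V W f (fun s : R => y + s *: w) t 1 w d AE fd).
Qed.

Lemma MVT_line (V : normedModType R) (f df : V -> R) y w (h : R) : 0 < h ->
  (forall t, 0 <= t <= h -> is_derive (y + t *: w) w f (df (y + t *: w))) ->
  exists2 t, 0 <= t <= h & f (y + h *: w) - f y = df (y + t *: w) * h.
Proof.
move=> h0 fd; have line t : 0 <= t <= h ->
    is_derive t 1 (fun s : R => f (y + s *: w)) (df (y + t *: w)).
  by move=> /fd; exact: is_derive_line.
have [t|t|t] := @MVT R (fun s => f (y + s *: w)) (fun s => df (y + s *: w)) _ _ h0.
- by rewrite in_itv /= => /andP[/ltW a /ltW b]; apply: line; rewrite a b.
- apply: derivable_within_continuous => s; rewrite in_itv /= => s0h.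
  by case: (line s s0h).
- rewrite in_itv /= scale0r addr0 subr0 => /andP[/ltW a /ltW b] E.
  by exists t; rewrite ?a ?b.
Qed.

Lemma nbhs_square (V : normedModType R) (x u v : V) (P : set V) :
  (\forall y \near x, P y) -> exists2 h : R, 0 < h &
    forall s t, 0 <= s <= h -> 0 <= t <= h -> P (x + s *: u + t *: v).
Proof.
move=> nP; have : continuous (fun z : R^o * R^o => x + z.1 *: u + z.2 *: v).
  move=> z; apply: cvgD; first apply: cvgD; first exact: cvg_cst.
    by apply: cvgZl; exact: cvg_fst.
  by apply: cvgZl; exact: cvg_snd.
move=> /(_ (0, 0)) /(_ P); rewrite /= !scale0r !addr0 => /(_ nP).
move=> [[A B] /= [/nbhs_ballP[a /= a0 aA] /nbhs_ballP[b /= b0 bB]] AB].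
exists (Num.min a b / 2) => [|s t /andP[s0 sh] /andP[t0 th]].
  by rewrite divr_gt0 // lt_min a0 b0.
have m2 : Num.min a b / 2 < Num.min a b.
  by rewrite ltr_pdivrMr // ltr_pMr ?ltr1n // lt_min a0 b0.
apply: (AB (s, t)); split => /=.
- apply: aA; rewrite /ball /= sub0r normrN ger0_norm //.
  by rewrite (le_lt_trans sh) // (lt_le_trans m2) // ge_min lexx.
- apply: bB; rewrite /ball /= sub0r normrN ger0_norm //.
  by rewrite (le_lt_trans th) // (lt_le_trans m2) // ge_min lexx orbT.
Qed.

Lemma schwarz_scalar (V : normedModType R) (x u v : V) (f fu fv fuv fvu : V -> R) :
  (\forall y \near x, is_derive y u f (fu y)) ->
  (\forall y \near x, is_derive y v f (fv y)) ->
  (\forall y \near x, is_derive y v fu (fuv y)) ->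
  (\forall y \near x, is_derive y u fv (fvu y)) ->
  {for x, continuous fuv} -> {for x, continuous fvu} -> fuv x = fvu x.
Proof.
(* The second difference of f over a small square is h^2 fuv at one point and
   h^2 fvu at another one. *)
move=> du dv duv dvu cuv cvu.
(* The two mixed derivatives at x differ by at most any e > 0, each of them varying by less than e /
   2 on the square. *)
apply/eqP; rewrite -subr_eq0 -normr_le0; apply/ler_addgt0Pl => e e0.
rewrite addr0.
have e2 : 0 < e / 2 by rewrite divr_gt0.
have nuv : \forall y \near x, `|fuv x - fuv y| < e / 2.
  by move/cvgrPdist_lt : cuv => /(_ _ e2).
have nvu : \forall y \near x, `|fvu x - fvu y| < e / 2.
  by move/cvgrPdist_lt : cvu => /(_ _ e2).
have [h h0 sq] := nbhs_square u v (filterI (filterI (filterI du dv) (filterI duv dvu))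
  (filterI nuv nvu)).
have h0h : 0 <= h <= h by rewrite lexx ltW.
have zh : 0 <= (0 : R) <= h by rewrite lexx ltW.
pose D := (f (x + h *: u + h *: v) - f (x + h *: u)) - (f (x + h *: v) - f x).
have [t1 t1h [t2 t2h D1]] : exists2 s, 0 <= s <= h & exists2 t, 0 <= t <= h &
    D = fuv (x + s *: u + t *: v) * h * h.
  have [|s sh E] := @MVT_line V (fun y => f (y + h *: v) - f y)
      (fun y => fu (y + h *: v) - fu y) x u h h0.
    move=> t th; apply: is_deriveB.
      apply: (@is_derive_affine V V R^o f (fun y => y + h *: v) _ u u) => [k|].
        by rewrite !addrA.
      by have [[[]]] := sq t h th h0h.
    by have [[[]]] := sq t 0 th zh; rewrite scale0r addr0.
  exists s => //.
  have [|t th E2] := @MVT_line V fu fuv (x + s *: u) v h h0.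
    by move=> t th; have [[_ []]] := sq s t sh th.
  by exists t => //; rewrite -E2 -E /D; ring.
have [t3 t3h [t4 t4h D2]] : exists2 s, 0 <= s <= h & exists2 t, 0 <= t <= h &
    D = fvu (x + s *: u + t *: v) * h * h.
  have [|t th E] := @MVT_line V (fun y => f (y + h *: u) - f y)
      (fun y => fv (y + h *: u) - fv y) x v h h0.
    move=> t th; apply: is_deriveB.
      apply: (@is_derive_affine V V R^o f (fun y => y + h *: u) _ v v) => [k|].
        by rewrite !addrA.
      by have [[[_]]] := sq h t h0h th; rewrite addrAC.
    by have [[[_]]] := sq 0 t zh th; rewrite scale0r addr0.
  have [|s sh E2] := @MVT_line V fv fvu (x + t *: v) u h h0.
    by move=> s sh; have [[_ [_]]] := sq s t sh th; rewrite addrAC.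
  exists s => //; exists t => //.
  by rewrite [x + s *: u + _]addrAC -E2 -E /D [x + h *: v + _]addrAC; ring.
have : fuv (x + t1 *: u + t2 *: v) = fvu (x + t3 *: u + t4 *: v).
  apply: (mulIf (lt0r_neq0 h0)); apply: (mulIf (lt0r_neq0 h0)).
  by rewrite -D1 -D2.
have [_ [a _]] := sq t1 t2 t1h t2h; have [_ [_ b]] := sq t3 t4 t3h t4h.
move=> E; rewrite (_ : fuv x - fvu x = (fuv x - fuv (x + t1 *: u + t2 *: v)) -
   (fvu x - fvu (x + t3 *: u + t4 *: v))); last by rewrite E; ring.
rewrite (le_trans (ler_normB _ _)) // (splitr e) lerD // ltW //.
Qed.

Lemma is_derive_mxP (V : normedModType R) m n (F : V -> 'M[R]_(m, n)) x v
    (d : 'M[R]_(m, n)) :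
  is_derive x v F d <->
  forall i j, is_derive x v (fun y => F y i j : R) (d i j).
Proof.
split=> [[dF <-] i j|H].
  have /derivable_mxP/(_ i j) dFij := dF.
  by split=> //; rewrite derive_mx // mxE.
have dF : derivable F x v by apply/derivable_mxP => i j; case: (H i j).
split=> //; rewrite derive_mx //; apply/matrixP => i j; rewrite mxE.
by case: (H i j).
Qed.

Lemma is_derive_fsum (V W : normedModType R) (I : finType) (h : I -> V -> W)
    x v (dh : I -> W) : (forall i, is_derive x v (h i) (dh i)) ->
  is_derive x v (fun y => \sum_i h i y) (\sum_i dh i).
Proof.
move=> H; rewrite (_ : (fun y => _) = \sum_i h i); last first.
  by apply/funext => y; rewrite fct_sumE.
by elim/big_ind2 : _ => // [|] *; [exact: is_derive_cst|exact: is_deriveD].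
Qed.

Lemma is_derive_mulmx (V : normedModType R) m n p (F : V -> 'M[R]_(m, n))
    (G : V -> 'M[R]_(n, p)) x v dF dG :
  is_derive x v F dF -> is_derive x v G dG ->
  is_derive x v (fun y => F y *m G y) (dF *m G x + F x *m dG).
Proof.
move=> /is_derive_mxP HF /is_derive_mxP HG; apply/is_derive_mxP => i j.
rewrite !mxE -big_split /=.
rewrite (_ : (fun y => _) = fun y => \sum_k F y i k * G y k j); last first.
  by apply/funext => y; rewrite mxE.
apply: is_derive_fsum => k.
have d := @is_deriveM _ _ (fun y => F y i k) (fun y => G y k j) x v _ _
  (HF i k) (HG k j).
by apply: (is_derive_eq d); rewrite /= addrC [dF i k * _]mulrC.
Qed.

Lemma is_derive_trmx (V : normedModType R) m n (F : V -> 'M[R]_(m, n)) x v dF :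
  is_derive x v F dF -> is_derive x v (fun y => (F y)^T) dF^T.
Proof.
move=> /is_derive_mxP HF; apply/is_derive_mxP => i j; rewrite mxE.
by rewrite (_ : (fun y => _) = fun y => F y j i) //; apply/funext => y; rewrite mxE.
Qed.

Lemma schwarz (V : normedModType R) m n (f : V -> 'M[R]_(m, n)) (U : set V) x u v :
  open U -> Ck 2 U f -> U x -> 'D_u ('D_v f) x = 'D_v ('D_u f) x.
Proof.
move=> oU [df d2f] Ux; apply/matrixP => i j.
have nU : \forall y \near x, U y by exact: open_nbhs_nbhs.
have d1 w y : U y -> is_derive y w (fun z => f z i j : R) ('D_w f y i j).
  move=> Uy; have /is_derive_mxP : is_derive y w f ('D_w f y).
    by apply/derivableP/diff_derivable; exact: df.
  exact.
have d2 w w' y : U y ->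
    is_derive y w (fun z => 'D_w' f z i j : R) ('D_w ('D_w' f) y i j).
  move=> Uy; have /is_derive_mxP : is_derive y w ('D_w' f) ('D_w ('D_w' f) y).
    by apply/derivableP/diff_derivable; exact: (d2f w').1.
  exact.
have c2 w w' : {for x, continuous (fun y => 'D_w ('D_w' f) y i j : R)}.
  have c : {for x, continuous ('D_w ('D_w' f))} by exact: (d2f w').2.
  exact: (@continuous_comp _ _ _ _ (fun M : 'M[R]_(m, n) => M i j) x c
    (@coord_continuous _ _ _ i j _)).
apply: (@schwarz_scalar V x v u (fun z => f z i j) _ _
  (fun y => 'D_u ('D_v f) y i j) (fun y => 'D_v ('D_u f) y i j)).
- by apply: filterS nU => y; exact: d1.
- by apply: filterS nU => y; exact: d1.
- by apply: filterS nU => y; exact: d2.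
- by apply: filterS nU => y; exact: d2.
- exact: c2.
- exact: c2.
Qed.

(** The energy e = sum of u_i^2 satisfies e' <= K e with K = 2 C |I|, because the square of the sum
    of the |u_j| is at most |I| e. Hence e(t) exp(- K t) has nonpositive derivative on [0, 1] and
    starts at 0. *)
Lemma gronwall (I : finType) (u du : I -> R -> R) (C : R) : 0 <= C ->
  (forall i (t : R), 0 <= t <= 1 -> is_derive t 1 (u i) (du i t)) ->
  (forall i (t : R), 0 <= t <= 1 -> `|du i t| <= C * \sum_j `|u j t|) ->
  (forall i, u i 0 = 0) -> forall i, u i 1 = 0.
Proof.
move=> C0 Hd Hle u0.
pose e (t : R) := \sum_i u i t ^+ 2; pose K := 2 * C * #|I|%:R.
pose de (t : R) := \sum_i (u i t * du i t *+ 2).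
have dE (t : R) : 0 <= t <= 1 -> is_derive t 1 e (de t).
  move=> t01; apply: is_derive_fsum => i; have d := Hd i t t01.
  rewrite (_ : (fun y => _) = u i * u i :> (R -> R)); last first.
    by apply/funext => s; rewrite expr2.
  by apply: is_derive_eq; rewrite mulr2n.
have leE (t : R) : 0 <= t <= 1 -> de t <= K * e t.
  move=> t01; rewrite /de /K.
  have sq2 : (\sum_j `|u j t|) * (\sum_j `|u j t|) <= #|I|%:R * e t.
    rewrite big_distrl /=; under eq_bigr do rewrite big_distrr /=.
    apply: (@le_trans _ _ (\sum_i \sum_j ((u i t ^+ 2 + u j t ^+ 2) / 2))).
      apply: ler_sum => i _; apply: ler_sum => j _.
      rewrite ler_pdivlMr // -[u i t ^+ 2]real_normK ?num_real //.
      rewrite -[u j t ^+ 2]real_normK ?num_real //.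
      have := sqr_ge0 (`|u i t| - `|u j t|); rewrite sqrrB; lra.
    under eq_bigr do rewrite -mulr_suml big_split /= sumr_const.
    rewrite -mulr_suml big_split /= sumrMnl sumr_const -/(e t) -mulr_natl.
    rewrite -mulr_natl (_ : #|predT| = #|I|) //; lra.
  apply: (@le_trans _ _ (2 * C * ((\sum_j `|u j t|) * (\sum_j `|u j t|)))).
    pose S := \sum_j `|u j t|; rewrite -/S; rewrite (_ : 2 * C * (S * S) =
      \sum_i 2 * (`|u i t| * (C * S))); last first.
      by rewrite -mulr_sumr -mulr_suml -/S; ring.
    apply: ler_sum => i _; rewrite -mulr_natl ler_pM2l //.
    apply: (le_trans (ler_norm _)); rewrite normrM ler_wpM2l //; exact: Hle.
  by rewrite -!mulrA ler_pM2l // ler_wpM2l.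
pose f (t : R) := e t * expR (- K * t).
have df (t : R) : 0 <= t <= 1 ->
    is_derive t 1 f (expR (- K * t) * (de t - K * e t)).
  move=> t01; have d := dE t t01.
  have dK : is_derive t 1 (fun s : R => - K * s) (- K).
    apply: (is_derive_eq (is_deriveZ (- K) (is_derive_id (t : R^o) 1))).
    exact: mulr1.
  have dexp : is_derive t 1 (fun s => expR (- K * s)) (- K * expR (- K * t)).
    by apply: (is_derive_eq (is_derive1_comp _ dK)); rewrite mulrC.
  apply: (is_derive_eq (is_deriveM d dexp)).
  by rewrite /= -[_ *: _]/(_ * _) -[_ *: de t]/(_ * _); ring.
have f1 : f 1 <= 0.
  have [t|t|t] := @MVT R f (fun t => expR (- K * t) * (de t - K * e t)) _ _ ltr01.
  - by rewrite in_itv /= => /andP[/ltW a /ltW b]; apply: df; rewrite a b.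
  - by apply: derivable_within_continuous => s; rewrite in_itv /= => /df[].
  - rewrite in_itv /= subr0 mulr1 => /andP[/ltW a /ltW b].
    have -> : f 0 = 0.
      by rewrite /f /e big1 ?mul0r // => i _; rewrite u0 expr0n.
    rewrite subr0 => ->; rewrite pmulr_rle0 ?expR_gt0 // subr_le0.
    by apply: leE; rewrite a b.
move: f1; rewrite /f pmulr_lle0 ?expR_gt0 // => e1 i.
apply/eqP; rewrite -sqrf_eq0 -normr_le0 ger0_norm ?sqr_ge0 //.
apply: le_trans e1; rewrite /e (bigD1 i) //= lerDl; apply: sumr_ge0 => j _.
exact: sqr_ge0.
Qed.

End DirectionalDerivatives.

(** * Uniqueness for the Killing equation in a chart *)

Section PointwiseContinuity.
Context {R : realType} {T : topologicalType} (x : T).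

Lemma continuous_at_sum (I : Type) (s : seq I) (P : pred I) (f : I -> T -> R) :
  (forall i, P i -> {for x, continuous (f i)}) ->
  {for x, continuous (fun y => \sum_(i <- s | P i) f i y)}.
Proof. by move=> cf; apply: cvg_big => //; exact: add_continuous. Qed.

Lemma continuous_at_prod (I : Type) (s : seq I) (P : pred I) (f : I -> T -> R) :
  (forall i, P i -> {for x, continuous (f i)}) ->
  {for x, continuous (fun y => \prod_(i <- s | P i) f i y)}.
Proof. by move=> cf; apply: cvg_big => //; exact: mul_continuous. Qed.

Lemma continuous_at_entry m n (F : T -> 'M[R]_(m, n)) i j :
  {for x, continuous F} -> {for x, continuous (fun y => F y i j : R)}.
Proof.
move=> c; exact: (@continuous_comp _ _ _ _ (fun M : 'M[R]_(m, n) => M i j) x c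
  (@coord_continuous _ _ _ i j _)).
Qed.

Lemma continuous_at_det k (F : T -> 'M[R]_k) :
  (forall i j, {for x, continuous (fun y => F y i j : R)}) ->
  {for x, continuous (fun y => \det (F y))}.
Proof.
move=> cF; apply: continuous_at_sum => s _.
apply: cvgM; first exact: cvg_cst.
by apply: (@continuous_at_prod _ _ _ (fun i y => F y i ((s : 'S_k) i))).
Qed.

Lemma continuous_at_adj k (F : T -> 'M[R]_k) i j :
  (forall i j, {for x, continuous (fun y => F y i j : R)}) ->
  {for x, continuous (fun y => (\adj (F y)) i j : R)}.
Proof.
move=> cF; rewrite (_ : (fun y => _) = fun y => cofactor (F y) j i).
  apply: cvgM; first exact: cvg_cst.
  apply: continuous_at_det => a b.
  rewrite (_ : (fun y => _) = fun y => F y (lift j a) (lift i b)) //.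
  by apply/funext => y; rewrite !mxE.
by apply/funext => y; rewrite mxE.
Qed.

(** The estimate is required on a whole neighbourhood, with S evaluated at the moving point: S will
    be the norm of the 1-jet, and the constant must serve for all segments near x. *)
Definition dominated (S f : T -> R) :=
  exists C : R, \forall y \near x, `|f y| <= C * S y.

Lemma dominatedD S f g : dominated S f -> dominated S g ->
  dominated S (fun y => f y + g y).
Proof.
move=> [C nf] [D ng]; exists (C + D); near=> y.
rewrite mulrDl (le_trans (ler_normD _ _)) // lerD //.
- by near: y.
- by near: y.
Unshelve. all: by end_near. Qed.

Lemma dominatedM S (c : T -> R) f : {for x, continuous c} -> dominated S f ->
  dominated S (fun y => c y * f y).
Proof.
move=> cc [C nf]; exists ((`|c x| + 1) * C); near=> y.
rewrite normrM -mulrA ler_pM //; last by near: y.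
near: y; move/cvgrPdist_le : cc => /(_ 1 ltr01); apply: filterS => y cxy.
rewrite -[c y](subKr (c x)) (le_trans (ler_normB _ _)) //.
by rewrite lerD2l.
Unshelve. all: by end_near. Qed.

Lemma dominated0 S : dominated S (fun=> 0).
Proof. by exists 0; apply: nearW => y; rewrite normr0 mul0r. Qed.

Lemma dominated_sum S (I : finType) (f : I -> T -> R) :
  (forall i, dominated S (f i)) -> dominated S (fun y => \sum_i f i y).
Proof.
move=> df; rewrite (_ : (fun y => _) = \sum_i f i); last first.
  by apply/funext => y; rewrite fct_sumE.
by elim/big_ind: _ => // *; [exact: dominated0|exact: dominatedD].
Qed.

Lemma dominatedZ S k f : dominated S f -> dominated S (fun y => k * f y).
Proof. by apply: dominatedM; exact: cvg_cst. Qed.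

Lemma dominated_near S f g : (\forall y \near x, f y = g y) ->
  dominated S f -> dominated S g.
Proof.
move=> fg [C nf]; exists C; near=> y.
by rewrite -(near fg y) //; near: y.
Unshelve. all: by end_near. Qed.

End PointwiseContinuity.

Section Killing.
Context {R : realType} {n : nat}.
Local Notation E c := (delta_mx 0 c : 'rV[R]_n).
Local Notation D c f := ('D_(E c) f).

Lemma derive_row p q (f : 'rV[R]_n -> 'M[R]_(p, q)) x v : differentiable f x ->
  'D_v f x = \sum_c v 0 c *: D c f x.
Proof.
move=> df; rewrite deriveE // {1}[v]row_sum_delta linear_sum /=.
by apply: eq_bigr => c _; rewrite linearZ /= deriveE.
Qed.

Lemma is_derive_mul (V : normedModType R) (f g : V -> R) x v df dg :
  is_derive x v f df -> is_derive x v g dg ->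
  is_derive x v (fun y => f y * g y) (df * g x + f x * dg).
Proof.
move=> d1 d2; apply: (is_derive_eq (is_deriveM d1 d2)).
by rewrite /= addrC [df * _]mulrC.
Qed.

Lemma ball_segment (q y z : 'rV[R]_n) (e t : R) : ball q e y -> ball q e z ->
  0 <= t <= 1 -> ball q e (y + t *: (z - y)).
Proof.
rewrite -ball_normE /ball_ /= => qy qz /andP[t0 t1].
rewrite (_ : q - _ = (1 - t) *: (q - y) + t *: (q - z)); last first.
  by apply/matrixP => i j; rewrite !mxE; ring.
rewrite (le_lt_trans (ler_normD _ _)) // !normrZ ger0_norm ?subr_ge0 //.
rewrite (ger0_norm t0).
have [->|tn0] := eqVneq t 0; first by rewrite subr0 mul1r mul0r addr0.
have tp : 0 < t by rewrite lt_neqAle eq_sym tn0.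
have : t * `|q - z| < t * e by rewrite ltr_pM2l.
have : (1 - t) * `|q - y| <= (1 - t) * e.
  by rewrite ler_wpM2l ?subr_ge0 // ltW.
lra.
Qed.

Variables (U : set 'rV[R]_n) (G : 'rV[R]_n -> 'M[R]_n)
  (W : 'rV[R]_n -> 'rV[R]_n).
Hypotheses (openU : open U) (GC2 : Ck 2 U G) (WC2 : Ck 2 U W).
Hypotheses (Gsym : forall x, U x -> (G x)^T = G x)
  (Gunit : forall x, U x -> G x \in unitmx).

(* The coordinate form of L_W G = 0. Since ['J] acts on rows, ['J W x] is the
   transpose of the differential of W. *)
Definition killing_eq x :=
  'J W x *m G x + G x *m ('J W x)^T + 'D_(W x) G x = 0.

Hypothesis W_killing : forall x, U x -> killing_eq x.

Let d1 p q (f : 'rV[R]_n -> 'M[R]_(p, q)) x v i j : Ck 2 U f -> U x ->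
  is_derive x v (fun y => f y i j : R) ('D_v f x i j).
Proof.
move=> [df _] Ux; have /is_derive_mxP : is_derive x v f ('D_v f x).
  by apply/derivableP/diff_derivable; exact: df.
exact.
Qed.

Let d2 p q (f : 'rV[R]_n -> 'M[R]_(p, q)) x u v i j : Ck 2 U f -> U x ->
  is_derive x v (fun y => 'D_u f y i j : R) ('D_v ('D_u f) x i j).
Proof.
move=> [_ d2f] Ux; have /is_derive_mxP : is_derive x v ('D_u f) ('D_v ('D_u f) x).
  by apply/derivableP/diff_derivable; exact: (d2f u).1.
exact.
Qed.

Lemma killing_eq_entries x b c : U x ->
  \sum_a D b W x 0 a * G x a c + \sum_a G x b a * D c W x 0 a
  + \sum_k W x 0 k * D k G x b c = 0.
Proof.
move=> Ux; have := W_killing Ux; rewrite /killing_eq.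
have : forall i j, 'J W x i j = D i W x 0 j.
  move=> i j; rewrite deriveEjacobian; last exact: WC2.1.
  by rewrite -rowE [RHS]mxE.
move: ('J W x) => J JE; rewrite derive_row; last exact: GC2.1.
move=> /matrixP/(_ b c); rewrite !mxE summxE => JK; rewrite -[RHS]JK; congr (_ + _ + _).
- by apply: eq_bigr => a _; rewrite JE.
- by apply: eq_bigr => a _; rewrite !mxE JE.
- by apply: eq_bigr => k _; rewrite mxE.
Qed.

(* The lower order terms in the derivative along [E d] of the [(b, c)] entry
   of the Killing equation. *)
Let low d b c x : R :=
  \sum_a D b W x 0 a * D d G x a c + \sum_a D d G x b a * D c W x 0 a
  + \sum_k (D d W x 0 k * D k G x b c + W x 0 k * D d (D k G) x b c).

(** The second derivative of W along b and c, with its vector index lowered by G. *)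
Let second b c w x : R := \sum_a D c (D b W) x 0 a * G x a w.

Lemma killing_derivative x d b c : U x ->
  second b d c x + second c d b x + low d b c x = 0.
Proof.
move=> Ux.
pose K y := \sum_a D b W y 0 a * G y a c + \sum_a G y b a * D c W y 0 a
  + \sum_k W y 0 k * D k G y b c.
have K0 : is_derive x (E d) K 0.
  have nU : \forall y \near x, U y by exact: open_nbhs_nbhs.
  have c0 : is_derive x (E d) (cst (0 : R)) 0 by exact: is_derive_cst.
  apply: near_eq_is_derive c0.
  by apply: filterS nU => y Uy; rewrite /K killing_eq_entries.
have dK : is_derive x (E d) K
  (\sum_a (D d (D b W) x 0 a * G x a c + D b W x 0 a * D d G x a c)
   + \sum_a (D d G x b a * D c W x 0 a + G x b a * D d (D c W) x 0 a)
   + \sum_k (D d W x 0 k * D k G x b c + W x 0 k * D d (D k G) x b c)).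
  apply: is_deriveD; first apply: is_deriveD.
  - by apply: is_derive_fsum => a; apply: is_derive_mul; [exact: d2|exact: d1].
  - by apply: is_derive_fsum => a; apply: is_derive_mul; [exact: d1|exact: d2].
  - by apply: is_derive_fsum => a; apply: is_derive_mul; [exact: d1|exact: d2].
have := derive_val (is_derive := K0); rewrite (derive_val (is_derive := dK)) => <-.
rewrite /second /low !big_split /=.
rewrite (_ : \sum_a D d (D c W) x 0 a * G x a b =
  \sum_a G x b a * D d (D c W) x 0 a); last first.
  by apply: eq_bigr => a _; rewrite mulrC -{1}(Gsym Ux) mxE.
by ring.
Qed.

(* The second derivatives are recovered as in the formula for the Levi-Civita
   connection, because [second b c w] is symmetric in [b] and [c]. *)
Lemma second_koszul x b c d : U x ->
  second b c d x = - (low c b d x + low b c d x - low d b c x) / 2.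
Proof.
move=> Ux; have sym b' c' w : second b' c' w x = second c' b' w x.
  by apply: eq_bigr => a _; rewrite (schwarz _ _ openU WC2 Ux).
have := killing_derivative d b c Ux; have := killing_derivative c b d Ux.
have := killing_derivative b c d Ux.
rewrite (sym c b d) (sym d b c) (sym d c b); lra.
Qed.

Let jet (i : 'I_n + 'I_n * 'I_n) x : R :=
  match i with inl a => W x 0 a | inr p => D p.1 W x 0 p.2 end.

Let jet_norm x := \sum_i `|jet i x|.

Lemma second_derivative_dominated q b c a : U q ->
  dominated q jet_norm (fun x => D c (D b W) x 0 a).
Proof.
move=> Uq; have nU : \forall y \near q, U y by exact: open_nbhs_nbhs.
have jet_dom i : dominated q jet_norm (jet i).
  exists 1; apply: filterS nU => y _; rewrite mul1r /jet_norm (bigD1 i) //= lerDl.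
  by apply: sumr_ge0 => j _.
have cG k : {for q, continuous (D k G)}.
  by apply: differentiable_continuous; exact: (GC2.2 _).1.
have cGG k l : {for q, continuous (D k (D l G))} by exact: (GC2.2 _).2.
have cG0 : {for q, continuous G} by apply: differentiable_continuous; exact: GC2.1.
have low_dom d' b' c' : dominated q jet_norm (low d' b' c').
  apply: dominatedD; first apply: dominatedD.
  - apply: dominated_sum => a'.
    under eq_fun do rewrite mulrC.
    apply: dominatedM; first exact: continuous_at_entry.
    exact: (jet_dom (inr (b', a'))).
  - apply: dominated_sum => a'.
    apply: dominatedM; first exact: continuous_at_entry.
    exact: (jet_dom (inr (c', a'))).
  - apply: dominated_sum => k.
    under eq_fun do rewrite mulrC [W _ _ _ * _]mulrC.
    apply: dominatedD; apply: dominatedM; try exact: continuous_at_entry.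
      exact: (jet_dom (inr (d', k))).
    exact: (jet_dom (inl k)).
have second_dom w : dominated q jet_norm (second b c w).
  apply: (@dominated_near _ _ q _
    (fun x => - 2^-1 * (low c b w x + low b c w x + - 1 * low w b c x))).
    by apply: filterS nU => x Ux; rewrite second_koszul //; field.
  apply: dominatedZ; apply: dominatedD; last exact: dominatedZ.
  exact: dominatedD.
(* The vector index is raised again by the inverse of G, written with cofactors so that the
   continuity of its entries follows from that of determinants. *)
apply: (@dominated_near _ _ q _ (fun x => \sum_w
    ((\det (G x))^-1 * (\adj (G x)) w a) * second b c w x)).
  apply: filterS nU => x Ux; have Gx := Gunit Ux.
  have invE w : (\det (G x))^-1 * (\adj (G x)) w a = invmx (G x) w a.
    by rewrite /invmx Gx [RHS]mxE.
  have -> : D c (D b W) x = D c (D b W) x *m G x *m invmx (G x).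
    by rewrite mulmxK.
  by rewrite mxE; apply: eq_bigr => w _; rewrite invE mulrC mxE.
apply: dominated_sum => w; apply: dominatedM => //.
have detq : {for q, continuous (fun x => \det (G x))}.
  by apply: continuous_at_det => i j; exact: continuous_at_entry.
have detq0 : \det (G q) != 0 by have := Gunit Uq; rewrite unitmxE unitfE.
apply: (cvgM (cvgV detq0 detq)).
by apply: continuous_at_adj => i j; exact: continuous_at_entry.
Qed.

(** Balls are convex, so y and z are joined by a segment along which Gronwall's inequality applies
    to the 1-jet. The base point y ranges over the whole ball because closedness of the zero set is
    tested at points near q. *)
Lemma killing_rigidity q : U q -> exists2 e : R, 0 < e & ball q e `<=` U /\
  forall y z, ball q e y -> ball q e z -> W y = 0 -> 'J W y = 0 -> W z = 0.
Proof.
move=> Uq.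
have [C C0 nC] : exists2 C : R, 0 <= C & \forall x \near q,
    forall p : 'I_n * 'I_n * 'I_n,
    `|D p.1.1 (D p.1.2 W) x 0 p.2| <= C * jet_norm x.
  have H (p : 'I_n * 'I_n * 'I_n) : {C | \forall x \near q,
     `|D p.1.1 (D p.1.2 W) x 0 p.2| <= C * jet_norm x}.
    by apply/cid; exact: second_derivative_dominated.
  exists (\sum_p `|sval (H p)|); first exact: sumr_ge0.
  apply: (@filter_forall _ _ (fun p x => `|D p.1.1 (D p.1.2 W) x 0 p.2| <=
    (\sum_p `|sval (H p)|) * jet_norm x) (nbhs q)) => p.
  apply: filterS (svalP (H p)) => x.
  move=> /le_trans; apply; rewrite ler_wpM2r //; first exact: sumr_ge0.
  rewrite (le_trans (ler_norm _)) // (bigD1 p) //= lerDl.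
  exact: sumr_ge0.
have nU : \forall y \near q, U y by exact: open_nbhs_nbhs.
have [e /= e0 eP] := (nbhs_ballP _ _).1 (filterI nU nC).
exists e => //; split=> [y /eP[]//|y z ey ez W0 J0].
pose v := z - y; pose V := \sum_c `|v 0 c|.
have V0 : 0 <= V by exact: sumr_ge0.
pose u i t := jet i (y + t *: v).
pose du (i : 'I_n + 'I_n * 'I_n) (t : R) := match i with
  | inl a => 'D_v W (y + t *: v) 0 a
  | inr p => 'D_v (D p.1 W) (y + t *: v) 0 p.2 end.
have seg t : 0 <= t <= 1 -> ball q e (y + t *: v) by exact: ball_segment.
have lin_bound p (f : 'I_n -> 'M[R]_(1, p)) a B :
    (forall c, `|f c 0 a| <= B) -> `|(\sum_c v 0 c *: f c) 0 a| <= V * B.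
  move=> fB; rewrite summxE (le_trans (ler_norm_sum _ _ _)) // mulr_suml.
  by apply: ler_sum => c _; rewrite mxE normrM ler_wpM2l.
have u1 i : u i 1 = 0.
  (* V comes from differentiating along v, 1 bounds the first derivatives, which belong to the jet
     themselves, and C bounds the second ones. *)
  apply: (@gronwall _ _ u du (V * (1 + C))).
  - by rewrite mulr_ge0 // addr_ge0.
  - move=> {}i t /seg/eP[Ut _]; apply: is_derive_line.
    by case: i => [a|[b a]]; [exact: d1|exact: d2].
  - move=> {}i t /seg/eP[Ut nCt]; rewrite -/(jet_norm _).
    have S0 : 0 <= jet_norm (y + t *: v) by exact: sumr_ge0.
    rewrite -mulrA; case: i => [a|[b a]] /=.
    + rewrite derive_row; last exact: WC2.1.
      apply: lin_bound => c; rewrite mulrDl mul1r ler_wpDr ?mulr_ge0 //.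
      rewrite /jet_norm (bigD1 (inr (c, a))) //= lerDl.
      exact: sumr_ge0.
    + rewrite derive_row; last exact: (WC2.2 _).1.
      apply: lin_bound => c; rewrite mulrDl mul1r ler_wpDl //.
      exact: (nCt (c, b, a)).
  - case=> [a|[b a]]; rewrite /u scale0r addr0 /=; first by rewrite W0 mxE.
    have [Uy _] := eP _ ey; rewrite deriveEjacobian ?J0 ?mulmx0 ?mxE //.
    exact: WC2.1.
apply/matrixP => i a; rewrite ord1 mxE -(u1 (inl a)) /u /= scale1r.
by rewrite addrC subrK.
Qed.

End Killing.

(** * Infinitesimal invariance under a flow *)

Section CkFacts.
Context {R : realType}.

Lemma near_eq_differentiable (V W : normedModType R) (f g : V -> W) x :
  (\forall y \near x, f y = g y) -> differentiable f x -> differentiable g x.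
Proof.
move=> fg df; have /diff_locallyP[cf /eqaddoP fo] := df.
have go : g \o shift x = cst (g x) + 'd f x +o_ 0 id.
  apply/eqaddoP => e e0; have fo' := fo e e0.
  have fg0 : \forall y \near (0 : V), f (y + x) = g (y + x).
    have cs : (shift x y @[y --> (0 : V)] --> x).
      rewrite -[X in _ --> X]add0r; apply: cvgD; [exact: cvg_id|exact: cvg_cst].
    exact: cs fg.
  apply: filterS2 fo' fg0 => y /= + E.
  by rewrite !fctE /= E (nbhs_singleton fg).
have E := diff_unique cf go.
by apply/diff_locallyP; rewrite E; split.
Qed.

Lemma Ck_ext (V W : normedModType R) k (U : set V) (f g : V -> W) : open U ->
  (forall x, U x -> f x = g x) -> Ck k U f -> Ck k U g.
Proof.
move=> oU; elim: k f g => [|k IH] f g fg /=.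
  move=> cf x Ux; have nU : \forall y \near x, f y = g y.
    by apply: filterS (open_nbhs_nbhs (conj oU Ux)) => y /fg.
  rewrite /prop_for /continuous_at -(fg x Ux).
  exact: cvg_trans (near_eq_cvg nU) (cf x Ux).
have nfg x : U x -> \forall y \near x, f y = g y.
  by move=> Ux; apply: filterS (open_nbhs_nbhs (conj oU Ux)) => y /fg.
move=> [df dkf]; split=> [x Ux|v].
  exact: near_eq_differentiable (nfg x Ux) (df x Ux).
by apply: IH (dkf v) => x Ux; exact: near_eq_derive (nfg x Ux).
Qed.

Lemma Ck_cst (V W : normedModType R) k (U : set V) (c : W) : Ck k U (fun _ : V => c).
Proof.
elim: k c => [|k IH] c /=; first by move=> x _; exact: cvg_cst.
split=> [x _|v]; first exact: differentiable_cst.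
rewrite (_ : 'D_v _ = fun=> 0); first exact: IH.
by apply/funext => x; exact: derive_cst.
Qed.

Lemma Ck_comb (V W : normedModType R) k (U : set V) (f g : V -> W) (c : R) :
  open U -> Ck k U f -> Ck k U g -> Ck k U (fun x => c *: f x + g x).
Proof.
move=> oU; elim: k f g => [|k IH] f g /=.
  move=> cf cg x Ux; apply: cvgD; last exact: cg.
  by apply: cvgZr; exact: cf.
move=> [df dkf] [dg dkg]; split=> [x Ux|v].
  apply: differentiableD; last exact: dg.
  by apply: differentiableZ; exact: df.
apply: (Ck_ext oU _ (IH _ _ (dkf v) (dkg v))) => x Ux.
have dfx : is_derive x v f ('D_v f x) by apply/derivableP/diff_derivable/df.
have dgx : is_derive x v g ('D_v g x) by apply/derivableP/diff_derivable/dg.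
exact/esym/derive_val.
Qed.

Lemma slice_affine (V : normedModType R) (x v : V) (t h : R) :
  ((t, h *: v + x) : R^o * V) = h *: ((0, v) : R^o * V) + (t, x).
Proof. by congr pair; rewrite /= scaler0 add0r. Qed.

Lemma differentiable_slice (V : normedModType R) (t : R) (x : V) :
  differentiable (fun y : V => (t, y) : R^o * V) x.
Proof. by apply: differentiable_pair; [exact: differentiable_cst|]. Qed.

Lemma differentiable_slice_comp (V W : normedModType R) (F : R^o * V -> W)
    (t : R) (x : V) :
  differentiable F (t, x) -> differentiable (fun y => F (t, y)) x.
Proof.
move=> dF; exact: (@differentiable_comp _ _ _ _ (fun y : V => (t, y) : R^o * V) F x
  (differentiable_slice t x) dF).
Qed.

Lemma open_slice (V : normedModType R) (Om : set (R^o * V)) (t : R) : open Om ->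
  open [set y | Om (t, y)].
Proof.
move=> oO; apply: (@open_comp _ _ (fun y : V => (t, y) : R^o * V) Om) oO => x _.
exact/differentiable_continuous/differentiable_slice.
Qed.

Lemma derive_slice (V W : normedModType R) (F : R^o * V -> W) (t : R) x v :
  'D_v (fun y => F (t, y)) x = 'D_(0, v) F (t, x).
Proof.
exact: (@derive_affine _ V _ W F (fun y => (t, y)) x v (0, v)
  (slice_affine x v t)).
Qed.

Lemma Ck_slice (V W : normedModType R) k (Om : set (R^o * V)) (F : R^o * V -> W)
    (t : R) : Ck k Om F -> Ck k [set y | Om (t, y)] (fun y => F (t, y)).
Proof.
elim: k F => [|k IH] F /=.
  move=> cF x Ox; apply: (@continuous_comp _ _ _ (fun y : V => (t, y) : R^o * V) F).
    exact/differentiable_continuous/differentiable_slice.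
  exact: cF.
move=> [dF dkF]; split=> [x Ox|v].
  apply: differentiable_slice_comp; exact: dF.
rewrite (_ : 'D_v _ = fun y => 'D_(0, v) F (t, y)); first exact: (IH _ (dkF (0, v))).
by apply/funext => y; exact: derive_slice.
Qed.

Lemma is_derive_time (V W : normedModType R) (F : R^o * V -> W) (t : R) x d :
  is_derive (t, x) ((1, 0) : R^o * V) F d ->
  is_derive t 1 (fun s : R => F (s, x)) d.
Proof.
have AE (h : R) : ((h *: (1 : R^o) + t, x) : R^o * V) =
    h *: ((1, 0) : R^o * V) + (t, x).
  by congr pair; rewrite /= scaler0 add0r.
exact: (@is_derive_affine _ R^o _ W F (fun s => (s, x)) t 1 (1, 0) d AE).
Qed.

Lemma derive_time (V W : normedModType R) (F : R^o * V -> W) (t : R) x :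
  'D_1 (fun s : R => F (s, x)) t = 'D_(1, 0) F (t, x).
Proof.
have AE (h : R) : ((h *: (1 : R^o) + t, x) : R^o * V) =
    h *: ((1, 0) : R^o * V) + (t, x).
  by congr pair; rewrite /= scaler0 add0r.
exact: (@derive_affine _ R^o _ W F (fun s => (s, x)) t 1 (1, 0) AE).
Qed.

Lemma is_derive_chain (V W : normedModType R) (c : R -> V) (G : V -> W) (t : R) w :
  is_derive t 1 c w -> differentiable G (c t) ->
  is_derive t 1 (fun s => G (c s)) ('D_w G (c t)).
Proof.
move=> [/derivable1_diffP dc cw] dG.
have dGc : differentiable (G \o c) t by exact: differentiable_comp.
split; first exact: diff_derivable.
rewrite -[LHS]/('D_1 (G \o c) t) deriveE // diff_comp //= deriveE //.
by rewrite -cw deriveE.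
Qed.

Lemma jacobian_entry n m (f : 'rV[R]_n -> 'rV[R]_m) x i j : differentiable f x ->
  'J f x i j = 'D_(delta_mx 0 i) f x 0 j.
Proof. by move=> df; rewrite deriveEjacobian // -rowE [RHS]mxE. Qed.

Lemma jacobian_near n m (f g : 'rV[R]_n -> 'rV[R]_m) x :
  (\forall y \near x, f y = g y) -> differentiable f x -> 'J f x = 'J g x.
Proof.
move=> fg df; apply/matrixP => i j.
have dg := near_eq_differentiable fg df.
apply: (etrans (jacobian_entry i j df)).
apply: (etrans _ (esym (jacobian_entry i j dg))).
exact: (congr1 (fun M : 'rV_m => M 0 j) (near_eq_derive _ fg)).
Qed.

Lemma jacobian_id n (x : 'rV[R]_n) : 'J id x = 1%:M.
Proof.
apply/matrixP => i j; rewrite jacobian_entry; last exact: ex_diff.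
by rewrite derive_id !mxE eqxx eq_sym.
Qed.

Lemma jacobian_comb n m (f g : 'rV[R]_n -> 'rV[R]_m) x c :
  differentiable f x -> differentiable g x ->
  'J (fun y => c *: f y + g y) x = c *: 'J f x + 'J g x.
Proof.
move=> df dg; apply/matrixP => i j.
rewrite jacobian_entry; last first.
  by apply: differentiableD => //; exact: differentiableZ.
have dfx : is_derive x (delta_mx 0 i) f ('D_(delta_mx 0 i) f x).
  exact/derivableP/diff_derivable.
have dgx : is_derive x (delta_mx 0 i) g ('D_(delta_mx 0 i) g x).
  exact/derivableP/diff_derivable.
have -> : 'D_(delta_mx 0 i) (fun y => c *: f y + g y) x =
  c *: 'D_(delta_mx 0 i) f x + 'D_(delta_mx 0 i) g x by exact: derive_val.
rewrite mxE [X in X + _]mxE -(jacobian_entry _ _ df) -(jacobian_entry _ _ dg).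
move: ('J f x) ('J g x) => A B; by rewrite !mxE.
Qed.

End CkFacts.

Section Flow.
Context {R : realType} {n : nat}.
Variables (Om : set (R^o * 'rV[R]_n)) (F : R^o * 'rV[R]_n -> 'rV[R]_n).
Hypotheses (openOm : open Om) (FC2 : Ck 2 Om F).
Hypothesis F0 : forall y, Om (0, y) -> F (0, y) = y.

Definition generator y := 'D_(1, 0) F (0, y).

Variable x : 'rV[R]_n.
Hypothesis Omx : Om (0, x).

Let near_Om : \forall t \near (0 : R), Om (t, x).
Proof.
have : nbhs ((0, x) : R^o * 'rV[R]_n) Om by exact: open_nbhs_nbhs.
move=> [[A B] /= [A0 Bx] AB]; apply: filterS A0 => t At.
by apply: (AB (t, x)); split=> //=; exact: nbhs_singleton.
Qed.

Lemma is_derive_flow : is_derive (0 : R) (1 : R) (fun t : R => F (t, x)) (generator x).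
Proof. by apply/is_derive_time/derivableP/diff_derivable/FC2.1. Qed.

(** Symmetry of the mixed second derivatives in time and space exchanges the Jacobian with the time
    derivative. *)
Lemma is_derive_jacobian_flow :
  is_derive (0 : R) (1 : R) (fun t : R => 'J (fun y => F (t, y)) x) ('J generator x).
Proof.
have dslice t : Om (t, x) -> differentiable (fun y => F (t, y)) x.
  move=> Ot; apply: differentiable_slice_comp.
  exact: FC2.1.
have dgen : differentiable generator x.
  exact: (@differentiable_slice_comp _ _ _ ('D_(1, 0) F) 0 x ((FC2.2 _).1 _ Omx)).
apply/is_derive_mxP => i j.
apply: (@near_eq_is_derive _ _ _ (fun t : R => 'D_(0, delta_mx 0 i) F (t, x) 0 j)).
  apply: filterS near_Om => t Ot.
  by rewrite jacobian_entry ?derive_slice //; exact: dslice.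
rewrite jacobian_entry //; have -> : 'D_(delta_mx 0 i) generator x =
    'D_(0, delta_mx 0 i) ('D_(1, 0) F) (0, x) by exact: derive_slice.
rewrite -(schwarz _ _ openOm FC2 Omx).
have d2 : is_derive ((0, x) : R^o * 'rV[R]_n) (1, 0) ('D_(0, delta_mx 0 i) F)
    ('D_(1, 0) ('D_(0, delta_mx 0 i) F) (0, x)).
  by apply/derivableP/diff_derivable; exact: (FC2.2 _).1.
by move: (is_derive_time d2) => /is_derive_mxP.
Qed.

Let near_slice0 : \forall y \near x, F (0, y) = y.
Proof.
apply: filterS F0 _.
by apply: open_nbhs_nbhs; split; [exact: open_slice|].
Qed.

Let jacobian_flow0 : 'J (fun y => F (0, y)) x = 1%:M.
Proof.
rewrite -(jacobian_id x); apply: jacobian_near near_slice0 _.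
by apply: differentiable_slice_comp; exact: FC2.1.
Qed.

Variable G : 'rV[R]_n -> 'M[R]_n.
Hypothesis dG : differentiable G x.
Hypothesis isometry : \forall t \near (0 : R),
  'J (fun y => F (t, y)) x *m G (F (t, x)) *m ('J (fun y => F (t, y)) x)^T = G x.

Let Fx : F (0, x) = x. Proof. exact: F0. Qed.

Let is_derive_tensor m p (T : 'rV[R]_n -> 'M[R]_(m, p)) : differentiable T x ->
  is_derive (0 : R) (1 : R) (fun t : R => T (F (t, x))) ('D_(generator x) T x).
Proof.
move=> dT; have := is_derive_chain is_derive_flow (G := T).
by rewrite Fx; exact.
Qed.

Lemma flow_killing : killing_eq G generator x.
Proof.
have dJ := is_derive_jacobian_flow.
have := is_derive_mulmx (is_derive_mulmx dJ (is_derive_tensor dG))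
  (is_derive_trmx dJ).
rewrite jacobian_flow0 Fx trmx1 !mulmx1 !mul1mx => d.
have c0 : is_derive (0 : R) (1 : R) (cst (G x)) (0 : 'M[R]_n) by exact: is_derive_cst.
have := near_eq_is_derive isometry d.
move=> d'; have := derive_val (is_derive := d').
rewrite (derive_val (is_derive := c0)) /killing_eq => ->.
by rewrite addrAC.
Qed.

Hypothesis Gunit : G x \in unitmx.
(** The space Q at x enters as the left kernel of [C]. In [preserved], [B] is the pull back to x of
    the endomorphism [T] at F_t x. *)
Variables (m : nat) (C : 'M[R]_(n * n, m)).
Variable T : 'rV[R]_n -> 'M[R]_n.
Hypothesis dT : differentiable T x.
Hypothesis preserved : \forall t \near (0 : R), exists2 B : 'M[R]_n,
  mxvec B *m C = 0 &
  T (F (t, x)) *m ('J (fun y => F (t, y)) x)^T =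
  ('J (fun y => F (t, y)) x)^T *m B.

(* [invmx (G x) *m 'J F_t x *m G (F_t x)] is the inverse of the differential of
   the isometry [F_t]. *)
Lemma flow_endomorphism :
  mxvec ('D_(generator x) T x + T x *m ('J generator x)^T
     - ('J generator x)^T *m T x) *m C = 0.
Proof.
have dJ := is_derive_jacobian_flow.
have dB := is_derive_mulmx (is_derive_mulmx (is_derive_mulmx (is_derive_mulmx
  (is_derive_cst (invmx (G x)) (0 : R) 1) dJ) (is_derive_tensor dG))
  (is_derive_tensor dT)) (is_derive_trmx dJ).
move: dB; rewrite /= jacobian_flow0 Fx trmx1 !mulmx1 add0r mulVmx // !mul1mx.
move=> dB.
have BC0 : \forall t \near (0 : R), mxvec (invmx (G x) *m
    'J (fun y => F (t, y)) x *m G (F (t, x)) *m T (F (t, x)) *m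
    ('J (fun y => F (t, y)) x)^T) *m C = 0.
  apply: filterS2 isometry preserved => t iso [B BC TB].
  rewrite -mulmxA TB (_ : _ *m _ = invmx (G x) *m ('J (fun y => F (t, y)) x *m
    G (F (t, x)) *m ('J (fun y => F (t, y)) x)^T) *m B); last by rewrite !mulmxA.
  by rewrite iso mulVmx // mul1mx.
have c0 : is_derive (0 : R) (1 : R) (cst (0 : 'rV[R]_m)) 0 by exact: is_derive_cst.
have dmxvec (B : R -> 'M[R]_n) dB' : is_derive (0 : R) (1 : R) B dB' ->
    is_derive (0 : R) (1 : R) (fun t => mxvec (B t)) (mxvec dB').
  move=> /is_derive_mxP H; apply/is_derive_mxP => i k; rewrite ord1.
  case/mxvec_indexP: k => a b; rewrite mxvecE.
  rewrite (_ : (fun t => _) = fun t => B t a b) //.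
  by apply/funext => t; rewrite mxvecE.
have dBC := is_derive_mulmx (dmxvec _ _ dB) (is_derive_cst C (0 : R) 1).
have := derive_val (is_derive := near_eq_is_derive BC0 dBC).
rewrite (derive_val (is_derive := c0)) /= mulmx0 addr0 => /esym.
congr (mxvec _ *m C = 0).
have /eqP := flow_killing; rewrite /killing_eq addrAC addr_eq0 => /eqP kill.
(* The left-hand side is the derivative at t = 0 of the inverse differential; the Killing equation
   identifies it with minus the derivative of the differential. *)
have -> : invmx (G x) *m 'J generator x *m G x +
  invmx (G x) *m 'D_(generator x) G x = - ('J generator x)^T.
  by rewrite -mulmxA -mulmxDr kill mulmxN mulKmx.
by rewrite mulNmx -addrA addrC.
Qed.

End Flow.

(** * Killing fields preserving the even Clifford structure *)

Section KillingFields.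
Context {R : realType} {n r : nat} {M : manifold R n} {g : riemannian_metric M}.
Variable S : even_clifford_structure r g.
Implicit Types (X Y : vector_field M) (i j : Defs.index M).
Local Notation dm i := (Defs.dom (chart_of (i : Defs.index M))).
Local Notation co i := (Defs.coord (chart_of (i : Defs.index M))).
Local Notation pt i := (Defs.point_of (chart_of (i : Defs.index M))).
Local Notation im i := (co i @` dm i).

Definition local_field X i (y : 'rV[R]_n) : 'rV[R]_n := (X i (pt i y))^T.

Lemma metric_unit i p : dm i p -> g i p \in unitmx.
Proof.
move=> ip; apply: unitmx_injective => v gv; apply/eqP; apply: contraT => v0.
have := metric_pos g ip v0.
by rewrite -mulmxA gv mulmx0 mxE ltxx.
Qed.

Lemma chart_imP i y : im i y -> dm i (pt i y) /\ co i (pt i y) = y.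
Proof. by move=> [p ip <-]; rewrite coordK. Qed.

Lemma chart_im i p : dm i p -> im i (co i p).
Proof. by move=> ip; exists p. Qed.

Lemma metric_C2 i : Ck 2 (im i) (g i \o pt i).
Proof. exact: metric_smooth. Qed.

(* The displayed matrix is the Lie derivative of J_kl along X in the chart i. *)
Definition spin_invariant X := forall i V rho,
  local_even_clifford g (spin_bundle S) i V rho ->
  forall p, V p -> forall k l : 'I_r, (k < l)%N ->
  let T x := rho (pt i x) (cl_gen k * cl_gen l) in
  let W := local_field X i in
  spin_span (rho p) ('D_(W (co i p)) T (co i p) + T (co i p) *m ('J W (co i p))^T
    - ('J W (co i p))^T *m T (co i p)).

(* Sums of generators of one-parameter subgroups are not known to be complete, so
   linear combinations are taken among Killing fields rather than in [aut]. *)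
Record killing_field X : Prop := KillingField {
  killing_C2 : forall i, Ck 2 (im i) (local_field X i);
  killing_metric : forall i y, im i y -> killing_eq (g i \o pt i) (local_field X i) y;
  killing_tensor : forall i j q, dm i q -> dm j q ->
    X j q = diff_mx (M := M) id i j q *m X i q;
  killing_spin : spin_invariant X }.

Lemma derive_comb_dir p q (f : 'rV[R]_n -> 'M[R]_(p, q)) x c u v :
  differentiable f x -> 'D_(c *: u + v) f x = c *: 'D_u f x + 'D_v f x.
Proof. by move=> df; rewrite !deriveE // linearP. Qed.

Lemma local_smooth_diff i V rho (k l : 'I_r) p :
  local_even_clifford g (spin_bundle S) i V rho -> V p -> (k < l)%N ->
  differentiable (fun x => rho (pt i x) (cl_gen k * cl_gen l)) (co i p).
Proof.
move=> loc Vp kl; have [d _] := local_smooth loc kl 1; apply: d.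
by exists p.
Qed.

Lemma killing_field_comb X Y c : killing_field X -> killing_field Y ->
  killing_field (fun i p => c *: X i p + Y i p).
Proof.
move=> kX kY; have E i : local_field (fun i p => c *: X i p + Y i p) i =
    fun y => c *: local_field X i y + local_field Y i y.
  by apply/funext => y; rewrite /local_field linearP.
have dX i y (iy : im i y) : differentiable (local_field X i) y.
  exact: (killing_C2 kX i).1.
have dY i y (iy : im i y) : differentiable (local_field Y i) y.
  exact: (killing_C2 kY i).1.
have EJ i y (iy : im i y) : 'J (local_field (fun i p => c *: X i p + Y i p) i) y =
    c *: 'J (local_field X i) y + 'J (local_field Y i) y.
  by rewrite E jacobian_comb //; [exact: dX|exact: dY].
split=> [i|i y iy|i j q iq jq|i V rho loc p Vp k l kl T W].
- rewrite E; apply: Ck_comb; [exact: coord_open|exact: killing_C2|exact: killing_C2].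
- have := killing_metric kX iy; have := killing_metric kY iy.
  rewrite /killing_eq (EJ i y iy) E derive_comb_dir; last exact: (metric_C2 i).1.
  move: ('J _ _) ('J _ _) => A B kB kA.
  rewrite linearP /= mulmxDl mulmxDr -scalemxAl -scalemxAr.
  rewrite [X in X + _]addrACA -scalerDr addrACA -scalerDr.
  by rewrite kA kB scaler0 addr0.
- rewrite (killing_tensor kX iq jq) (killing_tensor kY iq jq).
  by rewrite mulmxDr scalemxAr.
- have ip := local_dom loc Vp; have iy := chart_im ip.
  have sX := killing_spin kX loc Vp kl; have sY := killing_spin kY loc Vp kl.
  rewrite /W {W} (EJ i _ iy) E derive_comb_dir; last exact: local_smooth_diff loc Vp kl.
  have := spin_spanD (spin_spanZ c sX) sY; congr spin_span.
  rewrite -/T; move: ('J _ _) ('J _ _) => A B.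
  rewrite linearP /= mulmxDl mulmxDr -scalemxAl -scalemxAr.
  move: ('D_ _ T _) ('D_ _ T _) (T _ *m _) (T _ *m _) (_ *m T _) (_ *m T _) => a b d e f h.
  by apply/matrixP => s t; rewrite !mxE; ring.
Qed.

Lemma killing_field0 : killing_field (fun _ _ => 0).
Proof.
have E i : local_field (fun _ _ => 0) i = cst 0.
  by apply/funext => y; rewrite /local_field trmx0.
have J0 i y : 'J (local_field (fun _ _ => 0) i) y = 0.
  rewrite E; apply/matrixP => a b.
  rewrite jacobian_entry; last exact: differentiable_cst.
  by rewrite derive_cst !mxE.
split=> [i|i y iy|i j q iq jq|i V rho loc p Vp k l kl T W].
- rewrite E; exact: Ck_cst.
- by rewrite /killing_eq J0 E derive0 trmx0 mul0mx mulmx0 !addr0.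
- by rewrite mulmx0.
- rewrite /W J0 E derive0 trmx0 mul0mx mulmx0 subr0 addr0; exact: spin_span0.
Qed.

Lemma killing_field_sum (I : Type) (s : seq I) (X : I -> vector_field M)
    (a : I -> R) : (forall l, killing_field (X l)) ->
  killing_field (fun i p => \sum_(l <- s) a l *: X l i p).
Proof.
move=> kX; elim: s => [|l s IH].
  rewrite (_ : (fun i p => _) = fun _ _ => 0); first exact: killing_field0.
  by apply/funext => i; apply/funext => p; rewrite big_nil.
rewrite (_ : (fun i p => _) =
    fun i p => a l *: X l i p + \sum_(l <- s) a l *: X l i p).
  exact: killing_field_comb.
by apply/funext => i; apply/funext => p; rewrite big_cons.
Qed.

Lemma jacobian_field_sum (I : Type) (s : seq I) (X : I -> vector_field M)
    (a : I -> R) i y : (forall l, killing_field (X l)) -> im i y ->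
  'J (local_field (fun i p => \sum_(l <- s) a l *: X l i p) i) y =
  \sum_(l <- s) a l *: 'J (local_field (X l) i) y.
Proof.
move=> kX iy; elim: s => [|l s IH].
  rewrite big_nil (_ : local_field _ i = cst 0).
    apply/matrixP => b c.
    rewrite jacobian_entry; last exact: differentiable_cst.
    by rewrite derive_cst !mxE.
  by apply/funext => z; rewrite /local_field big_nil trmx0.
rewrite big_cons -IH (_ : local_field _ i = fun z => a l *: local_field (X l) i z +
    local_field (fun i p => \sum_(l <- s) a l *: X l i p) i z).
  apply: jacobian_comb; first exact: (killing_C2 (kX l) i).1.
  exact: (killing_C2 (killing_field_sum s a kX) i).1.
by apply/funext => z; rewrite /local_field big_cons linearP.
Qed.

End KillingFields.

(** * From one-parameter groups of automorphisms to Killing fields, and the count of 1-jets *)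

Section AutKilling.
Context {R : realType} {n r : nat} {M : manifold R n} {g : riemannian_metric M}.
Variable S : even_clifford_structure r g.
Local Notation dm i := (Defs.dom (chart_of (i : Defs.index M))).
Local Notation co i := (Defs.coord (chart_of (i : Defs.index M))).
Local Notation pt i := (Defs.point_of (chart_of (i : Defs.index M))).
Local Notation im i := (co i @` dm i).

Lemma near_point i (y : 'rV[R]_n) (P : set M) : im i y ->
  (\forall q \near pt i y, P q) -> \forall z \near y, P (pt i z).
Proof. by move=> /point_of_continuous c nP; exact: c. Qed.

Lemma near_dom i p : dm i p -> \forall q \near p, dm i q.
Proof. by move=> ip; apply: open_nbhs_nbhs; split; [exact: dom_open|]. Qed.

Section Flow.
Variables (phi : R -> M -> M) (phi_flow : one_parameter_subgroup S phi).

Definition local_flow i (z : R^o * 'rV[R]_n) := co i (phi z.1 (pt i z.2)).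

Definition flow_domain i : set (R^o * 'rV[R]_n) :=
  [set z | im i z.2 /\ dm i (phi z.1 (pt i z.2))].

Lemma flow_domain_open i : open (flow_domain i).
Proof.
rewrite openE => -[t y] [/= iy ity].
have c1 : \forall z \near ((t, y) : R^o * 'rV[R]_n), im i z.2.
  have cs : (z.2 @[z --> ((t, y) : R^o * 'rV[R]_n)] --> y) by exact: cvg_snd.
  by apply: cs; apply: open_nbhs_nbhs; split; [exact: coord_open|].
have c2 : \forall z \near ((t, y) : R^o * 'rV[R]_n), dm i (phi z.1 (pt i z.2)).
  have cp : (((z.1 : R), pt i z.2) @[z --> ((t, y) : R^o * 'rV[R]_n)] -->
      ((t : R), pt i y)).
    have csnd : (z.2 @[z --> ((t, y) : R^o * 'rV[R]_n)] --> y) by exact: cvg_snd.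
    have cfst : ((z.1 : R) @[z --> ((t, y) : R^o * 'rV[R]_n)] --> (t : R)).
      exact: cvg_fst.
    exact: (cvg_pair cfst (cvg_comp _ _ csnd (point_of_continuous iy))).
  have cphi : {for ((t : R), pt i y), continuous (fun z : R * M => phi z.1 z.2)}.
    exact: (flow_continuous phi_flow).
  exact: (cvg_comp _ _ cp cphi) (near_dom ity).
by apply: filterS2 c1 c2 => z; split.
Qed.

Lemma flow_domain0 i y : flow_domain i (0, y) <-> im i y.
Proof.
split=> [[]//|iy]; split=> //=; rewrite (flow0 phi_flow).
by case: (chart_imP iy).
Qed.

Lemma local_flow0 i y : flow_domain i (0, y) -> local_flow i (0, y) = y.
Proof.
move=> /flow_domain0 iy; rewrite /local_flow /= (flow0 phi_flow).
by case: (chart_imP iy).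
Qed.

Lemma local_flow_C i k : Ck k (flow_domain i) (local_flow i).
Proof. exact: (flow_smooth phi_flow). Qed.

Lemma near_flow p (P : set M) : (\forall q \near p, P q) ->
  \forall t \near (0 : R), P (phi t p).
Proof.
move=> nP; have cp : (((t : R), p) @[t --> (0 : R)] --> ((0 : R), p)).
  have cid : (t @[t --> (0 : R)] --> (0 : R)) by exact: cvg_id.
  have ccst : (p @[t --> (0 : R)] --> p) by exact: cvg_cst.
  exact: (cvg_pair cid ccst).
have cphi : {for ((0 : R), p), continuous (fun z : R * M => phi z.1 z.2)}.
  exact: (flow_continuous phi_flow).
have c := cvg_comp _ _ cp cphi; apply: c; rewrite /= (flow0 phi_flow).
exact: nP.
Qed.

Lemma local_isometry i y : im i y -> \forall t \near (0 : R),
  'J (fun z => local_flow i (t, z)) y *m (g i \o pt i) (local_flow i (t, y)) *m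
  ('J (fun z => local_flow i (t, z)) y)^T = (g i \o pt i) y.
Proof.
move=> /chart_imP[ip iy]; have := near_flow (near_dom ip).
apply: filterS => t itp; have [_ _ inv _] := flow_Aut phi_flow t.
have := inv i i _ ip itp; rewrite /diff_mx iy trmxK.
by rewrite /= /local_flow /= (coordK itp).
Qed.

Variable X : vector_field M.
Hypothesis X_gen : forall i p, dm i p ->
  X i p = (derive1 (fun t : R => co i (phi t p)) 0)^T.

Lemma local_field_generator i y : im i y ->
  local_field X i y = generator (local_flow i) y.
Proof.
move=> /chart_imP[ip _]; rewrite /local_field X_gen // trmxK derive1E.
exact: (derive_time (local_flow i) 0 y).
Qed.

Lemma near_generator i y : im i y ->
  \forall z \near y, generator (local_flow i) z = local_field X i z.
Proof.
move=> iy; have : \forall z \near y, im i z.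
  by apply: open_nbhs_nbhs; split; [exact: coord_open|].
by apply: filterS => z iz; rewrite local_field_generator.
Qed.

Lemma generator_C2 i : Ck 2 (im i) (generator (local_flow i)).
Proof.
(* The flow is taken of class C^3, one derivative being spent on the generator. *)
have := @Ck_slice _ _ _ 2 (flow_domain i) ('D_(1, 0) (local_flow i)) 0
  ((local_flow_C i 3).2 (1, 0)).
rewrite (_ : [set y | _] = im i) //.
by apply/seteqP; split=> y /flow_domain0.
Qed.

Lemma jacobian_generator i y : im i y ->
  'J (local_field X i) y = 'J (generator (local_flow i)) y.
Proof.
move=> iy; apply/esym/jacobian_near; first exact: near_generator.
exact: (generator_C2 i).1.
Qed.

(** For small t the orbit of q stays in the chart i, and its image under the transition map is the
    orbit read in the chart j. The chain rule at t = 0 gives the change of charts. *)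
Lemma generator_tensor i j q : dm i q -> dm j q ->
  X j q = diff_mx (M := M) id i j q *m X i q.
Proof.
move=> iq jq; have iy := chart_im iq.
have dt : differentiable (co j \o pt i) (co i q).
  by have [d _] := manifold_transition i j 1; apply: d; exists q.
have Dgen := is_derive_flow (local_flow_C i 2) ((flow_domain0 _ _).2 iy).
have F0 := local_flow0 ((flow_domain0 _ _).2 iy).
have := is_derive_chain Dgen (G := co j \o pt i); rewrite F0 => /(_ dt) D.
have nE : \forall t \near (0 : R),
    (co j \o pt i) (local_flow i (t, co i q)) = co j (phi t q).
  have := near_flow (near_dom iq); apply: filterS => t itq.
  by rewrite /= /local_flow /= (coordK iq) (coordK itq).
have D' := near_eq_is_derive nE D.
rewrite (X_gen jq) derive1E (derive_val (is_derive := D')).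
rewrite deriveEjacobian // trmx_mul /diff_mx; congr (_ *m _).
by rewrite -(local_field_generator iy) /local_field trmxK coordK.
Qed.

Lemma generator_spin : spin_invariant S X.
Proof.
move=> i V rho loc p Vp k l kl T W.
have ip := local_dom loc Vp; have iy := chart_im ip.
have Vnear : \forall q \near p, V q.
  by apply: open_nbhs_nbhs; split; [exact: local_open loc|].
rewrite /W local_field_generator // jacobian_generator //.
(* The cokernel of [spin_mx] provides the matrix [C] of [flow_endomorphism]. *)
apply/spin_spanP; rewrite submxE; apply/eqP.
have Omy := (flow_domain0 i (co i p)).2 iy.
have gunit : (g i \o pt i) (co i p) \in unitmx.
  by rewrite /= coordK //; exact: metric_unit.
have H := (flow_endomorphism (@flow_domain_open i) (local_flow_C i 2)
  (@local_flow0 i) Omy ((metric_C2 i).1 _ iy) (local_isometry iy) gunit); apply: H.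
  exact: local_smooth_diff loc Vp kl.
have span_basis q : V q -> spin_bundle S i q (rho q (cl_gen k * cl_gen l)).
  move=> Vq; rewrite (local_span loc Vq) /=.
  exists (fun a b => ((a == k) && (b == l))%:R).
  rewrite (bigD1 k) //= [X in _ + X]big1 ?addr0 => [|a /negPf ak]; last first.
    by rewrite big1 // => b _; rewrite ak scale0r.
  rewrite (bigD1 l) //= !eqxx scale1r big1 ?addr0 // => b /andP[_ /negPf bl].
  by rewrite bl andbF scale0r.
apply: filterS2 (near_flow (filterI Vnear (near_dom ip))) (local_isometry iy).
move=> t [Vt itp] iso; have [_ _ _ inv] := flow_Aut phi_flow t.
(* Invariance of Q presents J_kl at the point phi_t p as the conjugate of some [A] in Q at p; this
   is the pull back required. *)
have := span_basis _ Vt; rewrite (inv i i _ ip itp) => -[A QA AE].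
exists A.
  apply/eqP; rewrite -submxE; apply/spin_spanP.
  move: QA; rewrite (local_span loc Vp) => -[a ->].
  apply: spin_span_sum => u _; apply: spin_span_sum => v uv; apply: spin_spanZ.
  rewrite rep_gen_mul //; apply: spin_span_basis; exact: card_pair.
(* The isometry relation makes the differential invertible, so that [invmx] in [AE] is a true
   inverse. *)
have Dunit : diff_mx (M := M) (phi t) i i p \in unitmx.
  have : (g i \o pt i) (co i p) \in unitmx by [].
  by rewrite -iso !unitmx_mul unitmx_tr => /andP[/andP[]].
have -> : T (local_flow i (t, co i p)) = rho (phi t p) (cl_gen k * cl_gen l).
  by rewrite /T /local_flow /= !coordK.
rewrite -AE -[('J _ _)^T]/(diff_mx (M := M) (phi t) i i p).
by rewrite mulmxKV.
Qed.

Lemma generator_killing : killing_field S X.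
Proof.
split=> [i|i y iy|i j q|].
- apply: (Ck_ext _ _ (generator_C2 i)) => [|y iy]; first exact: coord_open.
  by rewrite local_field_generator.
- rewrite /killing_eq jacobian_generator // local_field_generator //.
  apply: (flow_killing (@flow_domain_open i) (local_flow_C i 2)
    (@local_flow0 i) ((flow_domain0 _ _).2 iy) ((metric_C2 i).1 _ iy)).
  exact: local_isometry.
- exact: generator_tensor.
- exact: generator_spin.
Qed.

End Flow.

Lemma aut_killing X : aut S X -> killing_field S X.
Proof. by move=> [phi phi_flow X_gen]; exact: generator_killing X_gen. Qed.

Lemma killing_local_rigidity X i q : killing_field S X -> dm i q ->
  exists2 N : set M, nbhs q N & forall p, N p ->
    X i p = 0 -> 'J (local_field X i) (co i p) = 0 ->
    forall q' j, N q' -> dm j q' -> X j q' = 0.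
Proof.
move=> kX iq; have iy := chart_im iq.
have fieldE p : dm i p -> local_field X i (co i p) = (X i p)^T.
  by move=> ip; rewrite /local_field coordK.
have [e e0 [_ rig]] : exists2 e : R, 0 < e & ball (co i q) e `<=` im i /\
    forall y z, ball (co i q) e y -> ball (co i q) e z ->
    local_field X i y = 0 -> 'J (local_field X i) y = 0 -> local_field X i z = 0.
  apply: (killing_rigidity (@coord_open _ _ _ _) (metric_C2 (g := g) i) (killing_C2 kX i)) => //.
  - by move=> x /chart_imP[ix _]; exact: (Defs.metric_sym g ix).
  - by move=> x /chart_imP[ix _]; exact: metric_unit.
  - by move=> x; exact: (killing_metric kX).
exists (dm i `&` [set p | ball (co i q) e (co i p)]).
  apply: filterI; first exact: near_dom.
  by apply: (Defs.coord_continuous iq); exact: nbhsx_ballx.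
move=> p [ip bp] Xp Jp q' j [iq' bq'] jq'.
rewrite (killing_tensor kX iq' jq'); apply/eqP; apply: contraT.
have : local_field X i (co i q') = 0.
  by apply: rig bp bq' _ Jp; rewrite fieldE // Xp trmx0.
rewrite fieldE // => /(congr1 trmx); rewrite trmxK trmx0 => ->.
by rewrite mulmx0 eqxx.
Qed.

(** The set [Z] asks for vanishing on a neighbourhood and in every chart, which makes it open and
    spares a comparison of Jacobians in different charts. It is closed because near a limit point q
    there is a point of [Z], where the 1-jet vanishes, and local rigidity around q applies from that
    point. *)
Lemma killing_rigidity_connected X i p : connected [set: M] -> killing_field S X ->
  dm i p -> X i p = 0 -> 'J (local_field X i) (co i p) = 0 ->
  forall j q, dm j q -> X j q = 0.
Proof.
move=> conn kX ip Xp Jp.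
pose Z : set M := [set q | \forall q' \near q, forall j, dm j q' -> X j q' = 0].
have openZ : open Z.
  by rewrite openE => q /near_join; apply: filterS => q'.
have Zp : Z p.
  have [N Np rig] := killing_local_rigidity kX ip.
  apply: filterS (Np) => q Nq j jq; exact: (rig p (nbhs_singleton Np) Xp Jp q j Nq jq).
have closedZ : closed Z.
  move=> q clq; have [j jq] := manifold_cover q.
  have [N Nq rig] := killing_local_rigidity kX jq.
  have [q' [Zq' [Nq' jq']]] := clq _ (filterI Nq (near_dom jq)).
  apply: filterS Nq => q'' Nq'' l lq''; apply: (rig q' Nq' _ _ q'' l Nq'' lq'').
    exact: (nbhs_singleton Zq').
  have n0 : \forall y \near co j q', cst 0 y = local_field X j y.
    have jy := chart_im jq'.
    have := near_point (P := fun q' => forall j, dm j q' -> X j q' = 0) jy.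
    rewrite coordK // => /(_ Zq') nZ.
    have nj : \forall z \near co j q', im j z.
      by apply: open_nbhs_nbhs; split; [exact: coord_open|].
    apply: filterS2 nZ nj => z Xz /chart_imP[jz _].
    by rewrite /local_field Xz // trmx0.
  rewrite -(jacobian_near n0); last exact: differentiable_cst.
  apply/matrixP => a b; rewrite jacobian_entry; last exact: differentiable_cst.
  by rewrite derive_cst !mxE.
have ZT : Z = setT.
  apply: conn; first by exists p.
  - by exists Z => //; rewrite setTI.
  - by exists Z => //; rewrite setTI.
move=> j q; have : Z q by rewrite ZT.
by move=> /nbhs_singleton; exact.
Qed.

(** If k > b, the combinations vanishing at p form a space of dimension at least k - n, and their
    derivatives at p lie in a space of dimension at most b - n. Some nonzero combination has zero
    1-jet at p and vanishes everywhere, against independence. *)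
Lemma dim_bound b p i (rho : M -> clifford R r -> 'M[R]_n) k (X : 'I_k -> vector_field M) :
  connected [set: M] -> dm i p ->
  (exists2 V : set M, V p & local_even_clifford g (spin_bundle S) i V rho) ->
  normalizer_bound (g i p) (rho p) b ->
  (forall l, aut S (X l)) -> lin_indep X -> (k <= b)%N.
Proof.
move=> conn ip [V Vp loc] [Q Qb QP] autX indep.
have kX l := aut_killing (autX l); have iy := chart_im ip.
pose field (v : 'rV[R]_k) : vector_field M := fun j q => \sum_l v 0 l *: X l j q.
have kf v : killing_field S (field v) by exact: killing_field_sum.
pose Ev := \matrix_(l < k) (X l i p)^T.
pose Jac := \matrix_(l < k) mxvec ('J (local_field (X l) i) (co i p))^T.
have EvE v : v *m Ev = (field v i p)^T.
  rewrite mulmx_sum_row linear_sum; apply: eq_bigr => l _.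
  by rewrite rowK linearZ.
have JacE v : v *m Jac = mxvec ('J (local_field (field v) i) (co i p))^T.
  rewrite mulmx_sum_row (jacobian_field_sum _ _ kX iy) !linear_sum /=.
  by apply: eq_bigr => l _; rewrite rowK !linearZ.
rewrite leqNgt; apply/negP => bk.
have nz : (0 < \rank (kermx Ev :&: kermx Jac))%N.
  have := mxrank_mul_ker (kermx Ev) Jac; rewrite mxrank_ker.
  have : (\rank (kermx Ev *m Jac) <= \rank Q)%N.
    apply/mxrankS/row_subP => s; rewrite row_mul JacE.
    set v := row s _; apply: QP; have v0 : field v i p = 0.
      apply: trmx_inj; rewrite -EvE trmx0; apply/sub_kermxP; exact: row_sub.
    have W0 : local_field (field v) i (co i p) = 0.
      by rewrite /local_field coordK // v0 trmx0.
    split.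
      have := killing_metric (kf v) iy; rewrite /killing_eq W0 derive0 addr0.
      rewrite /= coordK // trmxK => /eqP; rewrite addr_eq0 => /eqP.
      by [].
    move=> a c ac Jac'.
    (* At a zero of the field the Lie derivative of J is J A - A J, the opposite of the bracket in
       [skew_spin_normalizer]. *)
    have := spin_spanZ (- 1) (killing_spin (kf v) loc Vp ac).
    rewrite W0 derive0 add0r coordK // scaleN1r opprB; exact.
  have h1 := rank_leq_col Ev; move=> h2 h3; move: h1 h2 h3 Qb bk.
  move: (\rank Ev) (\rank (kermx Ev *m Jac)) (\rank (kermx Ev :&: kermx Jac)) (\rank Q).
  lia.
have [v vK v0] : exists2 v : 'rV[R]_k, (v <= kermx Ev :&: kermx Jac)%MS & v != 0.
  by apply/rowV0Pn; rewrite -mxrank_eq0 -lt0n.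
move: vK; rewrite sub_capmx => /andP[/sub_kermxP vE /sub_kermxP vJ].
have f0 : field v i p = 0 by apply: trmx_inj; rewrite -EvE vE trmx0.
have j0 : 'J (local_field (field v) i) (co i p) = 0.
  apply: trmx_inj; apply: (can_inj mxvecK); rewrite -JacE vJ trmx0.
  by rewrite linear0.
have all0 := killing_rigidity_connected conn (kf v) ip f0 j0.
move/eqP: v0; apply; apply/matrixP => a l; rewrite ord1 mxE.
exact: (indep (fun l => v 0 l) all0).
Qed.

End AutKilling.

Lemma dim_Aut_bound (R : realType) (n r : nat) (M : manifold R n)
    (g : riemannian_metric M) (S : even_clifford_structure r g) b T :
  connected [set: M] -> locally_of_type S T ->
  (forall i p rho, Defs.dom (chart_of i) p -> linear_even_clifford (g i p) rho ->
     T rho -> normalizer_bound (g i p) rho b) ->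
  (dim_Aut S <= (b%:R)%:E)%E.
Proof.
move=> conn locT nb; apply: ge_ereal_sup => _ [k [X [autX indep]] <-].
rewrite lee_fin ler_nat.
have [[p _]|noM] := pselect (exists p : M, True).
  have [i ip] := manifold_cover p.
  have [V [rho [Vp loc Trho]]] := locT i p ip.
  have locV : exists2 V : set M, V p & local_even_clifford g (spin_bundle S) i V rho.
    by exists V.
  exact: (dim_bound conn ip locV
    (nb i p (rho p) ip (local_linear loc Vp) (Trho p Vp)) autX indep).
(* On the empty manifold every linear relation holds vacuously, so an independent family is
   empty. *)
case: k X autX indep => // k X _ indep.
suff : (1 : R) = 0 by move=> /eqP; rewrite oner_eq0.
by apply: (indep (fun=> 1) _ ord0) => i p; case: noM; exists p.
Qed.

Theorem proposition3p1 (R : realType) (N r : nat) (M : manifold R N)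
    (g : riemannian_metric M) (S : even_clifford_structure r g)
    (M_connected : connected [set: M]%classic) (r_ge3 : (3 <= r)%N) :
  (~~ (4 %| r)%N -> forall m : nat, has_multiplicity S m ->
     (dim_Aut S <= ((dmax r m)%:R : R)%:E)%E) /\
  ((4 %| r)%N -> forall m1 m2 : nat, has_multiplicities S m1 m2 ->
     (dim_Aut S <= ((dmax2 r m1 m2)%:R : R)%:E)%E).
Proof.
split=> [r4 m [delta [rep irr loc]]|r4 m1 m2 [delta1 [delta2 [[rep1 irr1] [rep2 irr2] neq loc]]]].
  apply: (dim_Aut_bound M_connected loc) => i p rho ip lin.
  apply: normalizer_bound_isotypic => //; first exact: metric_unit.
  exact: Defs.metric_sym.
apply: (dim_Aut_bound M_connected loc) => i p rho ip lin sumE.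
apply: (normalizer_bound_two_types _ _ _ _ r4 rep1 irr1 rep2 irr2 neq sumE) => //.
  exact: metric_unit.
exact: Defs.metric_sym.
Qed.
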